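(* Let $X$ be a Tychonoff space containing an infinite compact subspace and let $E$ be a Fréchet space which is not Montel. If $C_k(X,E)$ is an infinite-dimensional Fréchet space, then $C_k(X,E)$ contains a complemented copy of the Banach space $c_0$.
   Context: Spaces are over $\mathbb{R}$. A Fréchet space is a complete metrisable locally convex space. $C_k(X,E)$ is the space of all continuous functions $X\to E$ with the compact-open topology. Tychonoff means completely regular and Hausdorff. $c_0$ is the Banach space of real sequences converging to $0$ with the supremum norm. A locally convex space $G$ contains a complemented copy of $F$ if there are closed linear subspaces $G_1,G_2$ of $G$ with $G=G_1\oplus G_2$ algebraically, $G_1$ linearly homeomorphic to $F$, and the natural projection of $G$ onto $G_1$ continuous. *)

(* Defs.v *)
From HB Require Import structures.
From mathcomp Require Import all_boot all_order all_algebra.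
From mathcomp Require Import all_classical all_reals all_analysis.

Set Implicit Arguments.
Unset Strict Implicit.
Unset Printing Implicit Defensive.

Import Order.TTheory GRing.Theory Num.Theory.
Import numFieldNormedType.Exports.

Local Open Scope classical_set_scope.
Local Open Scope ring_scope.

(* [completely_regular_space] separates points from closed sets by means of a
   uniformity; [uniform_separatorP] is the functional form. *)
Definition tychonoff_space (X : topologicalType) : Prop :=
  completely_regular_space X /\ hausdorff_space X.

Section LocallyConvexSpaces.
Context {R : realType}.

Definition metrizable_space (T : topologicalType) : Prop :=
  exists (M : metricType R) (f : T -> M) (g : M -> T),
    [/\ cancel f g, cancel g f, continuous f & continuous g].

(* [tvsType] carries a uniformity that is only required to induce the topology;
   it need not be the translation-invariant one.  Completeness of a topological
   vector space refers to the latter, so Cauchy filters are defined here from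
   the neighbourhoods of 0 instead of through [cauchy]. *)
Definition tvs_cauchy (E : tvsType R) (F : set_system E) : Prop :=
  (fun xy : E * E => xy.1 - xy.2) @ (F, F) --> (0 : E).

Definition tvs_complete (E : tvsType R) : Prop :=
  forall F : set_system E, ProperFilter F -> tvs_cauchy F ->
    exists x : E, F --> x.

Definition frechet (E : tvsType R) : Prop :=
  metrizable_space E /\ tvs_complete E.

(* von Neumann boundedness; the library's [bounded_set] needs a norm *)
Definition tvs_bounded (E : tvsType R) (A : set E) : Prop :=
  forall U : set E, nbhs 0 U ->
    \forall r \near +oo_R, A `<=` [set r *: u | u in U].

Definition balanced_set (E : lmodType R) (A : set E) : Prop :=
  forall r : R, `|r| <= 1 -> [set r *: a | a in A] `<=` A.

Definition absorbing_set (E : lmodType R) (A : set E) : Prop :=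
  forall x : E, \forall r \near +oo_R, [set r *: a | a in A] x.

Definition barrel (E : tvsType R) (A : set E) : Prop :=
  [/\ closed A, convex_set A, balanced_set A & absorbing_set A].

Definition barrelled (E : tvsType R) : Prop :=
  forall A : set E, barrel A -> nbhs 0 A.

Definition montel (E : tvsType R) : Prop :=
  [/\ hausdorff_space E, barrelled E &
      forall A : set E, closed A -> tvs_bounded A -> compact A].

Definition finite_dimensional (V : lmodType R) : Prop :=
  exists (n : nat) (e : 'I_n -> V),
    forall v : V, exists a : 'I_n -> R, v = \sum_(i < n) a i *: e i.

Definition closed_subspace (G : tvsType R) (A : set G) : Prop :=
  closed A /\ submod_closed [in A].

(* The sets [A], [G1] are used as types, carrying the subspace topology. *)
Definition linearly_homeomorphic_to (G F : tvsType R) (A : set G) : Prop :=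
  exists (h : F -> A) (g : A -> F),
    [/\ linear (set_val \o h : F -> G), cancel h g, cancel g h,
        continuous h & continuous g].

Definition algebraic_direct_sum (G : lmodType R) (G1 G2 : set G) : Prop :=
  forall x : G, exists! y : G * G, [/\ G1 y.1, G2 y.2 & x = y.1 + y.2].

Definition contains_complemented_copy (G F : tvsType R) : Prop :=
  exists G1 G2 : set G,
    [/\ closed_subspace G1, closed_subspace G2, algebraic_direct_sum G1 G2,
        linearly_homeomorphic_to F G1 &
        exists p : G -> G1,
          (forall (x1 : G1) (x2 : G2), p (set_val x1 + set_val x2) = x1) /\
          continuous p].

End LocallyConvexSpaces.
Arguments metrizable_space R T : clear implicits.

Definition Ck (X Y : topologicalType) : Type := continuousType X Y.

Section CkTopology.
Context (X Y : topologicalType).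

Definition Ck_fun (f : Ck X Y) : {compact-open, X -> Y} :=
  (f : continuousType X Y) : X -> Y.

HB.instance Definition _ := Choice.copy (Ck X Y) (continuousType X Y).
HB.instance Definition _ := Topological.copy (Ck X Y) (initial_topology Ck_fun).

Lemma Ck_continuous (f : Ck X Y) : continuous (Ck_fun f : X -> Y).
Proof. exact: (@cts_fun _ _ (f : continuousType X Y)). Qed.

Lemma CkP (f g : Ck X Y) : (forall x, Ck_fun f x = Ck_fun g x) -> f = g.
Proof. by move=> fg; apply/(@continuousEP X Y f g). Qed.

Definition mkCk (f : X -> Y) (cf : continuous f) : Ck X Y :=
  (mkcts cf : continuousType X Y).

End CkTopology.

Section CkTvs.
Context {R : realType} (X : topologicalType) (E : tvsType R).
Implicit Types f g h : Ck X E.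

Lemma Ck_zero_subproof : continuous (fun _ : X => 0 : E).
Proof. by move=> x; exact: cvg_cst. Qed.

Lemma Ck_opp_subproof f : continuous (fun x => - (Ck_fun f x : E)).
Proof.
move=> x; apply: (@continuous_comp X E E (Ck_fun f) -%R).
  exact: Ck_continuous.
exact: opp_continuous.
Qed.

Lemma Ck_add_subproof f g :
  continuous (fun x => (Ck_fun f x : E) + (Ck_fun g x : E)).
Proof.
move=> x; apply: (@continuous_comp X (E * E)%type E
  (fun x => (Ck_fun f x : E, Ck_fun g x : E)) (fun z => z.1 + z.2)).
  by apply: cvg_pair; exact: Ck_continuous.
exact: add_continuous.
Qed.

Lemma Ck_scale_subproof (r : R) f :
  continuous (fun x => r *: (Ck_fun f x : E)).
Proof.
move=> x; apply: (@continuous_comp X (R^o * E)%type E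
  (fun x => (r : R^o, Ck_fun f x : E)) (fun z => z.1 *: z.2)).
  apply: (@cvg_pair _ _ _ _ (nbhs (r : R^o)));
    [exact: cvg_cst | exact: Ck_continuous].
exact: scale_continuous.
Qed.

Definition Ck_zero : Ck X E := mkCk Ck_zero_subproof.
Definition Ck_opp f : Ck X E := mkCk (@Ck_opp_subproof f).
Definition Ck_add f g : Ck X E := mkCk (@Ck_add_subproof f g).
Definition Ck_scale (r : R) f : Ck X E := mkCk (@Ck_scale_subproof r f).

Fact Ck_addA : associative Ck_add.
Proof. by move=> f g h; apply: CkP => x; exact: addrA. Qed.
Fact Ck_addC : commutative Ck_add.
Proof. by move=> f g; apply: CkP => x; exact: addrC. Qed.
Fact Ck_add0 : left_id Ck_zero Ck_add.
Proof. by move=> f; apply: CkP => x; exact: add0r. Qed.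
Fact Ck_addN : left_inverse Ck_zero Ck_opp Ck_add.
Proof. by move=> f; apply: CkP => x; exact: addNr. Qed.

HB.instance Definition _ :=
  GRing.isZmodule.Build (Ck X E) Ck_addA Ck_addC Ck_add0 Ck_addN.

Fact Ck_scaleA a b f : Ck_scale a (Ck_scale b f) = Ck_scale (a * b) f.
Proof. by apply: CkP => x; exact: scalerA. Qed.
Fact Ck_scale1 : left_id 1 Ck_scale.
Proof. by move=> f; apply: CkP => x; exact: scale1r. Qed.
Fact Ck_scaleDr : right_distributive Ck_scale +%R.
Proof. by move=> a f g; apply: CkP => x; exact: scalerDr. Qed.
Fact Ck_scaleDl f : {morph Ck_scale^~ f : a b / a + b}.
Proof. by move=> a b; apply: CkP => x; exact: scalerDl. Qed.

HB.instance Definition _ := GRing.Zmodule_isLmodule.Build R (Ck X E)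
  Ck_scaleA Ck_scale1 Ck_scaleDr Ck_scaleDl.

Lemma Ck_addE f g x : Ck_fun (f + g) x = (Ck_fun f x : E) + (Ck_fun g x : E).
Proof. by []. Qed.
Lemma Ck_oppE f x : Ck_fun (- f) x = - (Ck_fun f x : E).
Proof. by []. Qed.
Lemma Ck_scaleE (r : R) f x : Ck_fun (r *: f) x = r *: (Ck_fun f x : E).
Proof. by []. Qed.

Lemma Ck_open (K : set X) (O : set E) : compact K -> open O ->
  open [set g : Ck X E | (Ck_fun g : X -> E) @` K `<=` O].
Proof.
move=> cK oO; exists [set g : {compact-open, X -> E} | g @` K `<=` O] => //.
exact: compact_open_open.
Qed.

Lemma Ck_cvgP (F : set_system (Ck X E)) f : Filter F ->
  F --> f <-> forall K O, @compact X K -> @open E O ->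
    (Ck_fun f : X -> E) @` K `<=` O ->
    F [set g | (Ck_fun g : X -> E) @` K `<=` O].
Proof.
move=> FF; split=> [Ff K O cK oO fKO|H].
  by apply: Ff; apply: open_nbhs_nbhs; split => //; exact: Ck_open.
have Ff : (@Ck_fun X E) @ F --> Ck_fun f.
  exact/(compact_open_cvgP _ (fmap_filter _ FF)).
move=> U [_ [[B oB <-] Bf BU]]; apply: (filterS BU).
by apply: Ff; exact: open_nbhs_nbhs.
Qed.

Let shift_open (K : set X) (O : set E) f : compact K -> open O ->
  (Ck_fun f : X -> E) @` K `<=` O ->
  \forall w \near (0 : E), forall x, K x -> O ((Ck_fun f x : E) + w).
Proof.
move=> cK oO fKO.
move/compact_near_coveringP : cK => /(_ E (nbhs (0 : E))
  (fun w x => O ((Ck_fun f x : E) + w)) (nbhs_filter _)); apply => x Kx.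
have cf : {for (x, 0 : E),
    continuous (fun z : X * E => (Ck_fun f z.1 : E) + z.2)}.
  apply: (@continuous_comp (X * E)%type (E * E)%type E
    (fun z => (Ck_fun f z.1 : E, z.2)) (fun z => z.1 + z.2)).
    apply: cvg_pair; last exact: cvg_snd.
    apply: (@continuous_comp (X * E)%type X E fst (Ck_fun f)).
      exact: cvg_fst.
    exact: Ck_continuous.
  exact: add_continuous.
apply: cf; rewrite /= addr0; apply: open_nbhs_nbhs; split=> //.
by apply: fKO; exists x.
Qed.

Lemma Ck_cvg0P (F : set_system (Ck X E)) f : Filter F ->
  F --> f <-> forall (K : set X) (W : set E), compact K -> nbhs 0 W ->
    \forall g \near F, forall x, K x -> W ((Ck_fun g x : E) - Ck_fun f x).
Proof.
move=> FF; split=> [/Ck_cvgP Ff K W cK W0|H]; last first.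
  apply/Ck_cvgP => K O cK oO fKO.
  apply: filterS (H K _ cK (shift_open cK oO fKO)) => g gf _ [x Kx <-].
  by have := gf _ Kx _ Kx; rewrite addrC subrK.
move/compact_near_coveringP/near_covering_withinP : (cK).
apply => x Kx.
have [V V0 VW] : exists2 V : set E, nbhs 0 V &
    forall a b, V a -> V b -> W (a - b).
  have /(_ W) := @sub_continuous E (0, 0); rewrite /= subrr => /(_ W0).
  case=> -[A B] /= [A0 B0] AB; exists (A `&` B); first exact: filterI.
  by move=> a b [Aa _] [_ Bb]; exact: (AB (a, b)).
pose fx : E := Ck_fun f x.
have tV (a : E) : nbhs a [set y | V (y - a)].
  have /(_ V) : {for a, continuous (fun y : E => y - a)}.
    apply: (@continuous_comp E (E * E)%type E (fun y => (y, a))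
      (fun z => z.1 - z.2)); last exact: sub_continuous.
    by apply: cvg_pair; [exact: cvg_id | exact: cvg_cst].
  by rewrite /= subrr; apply.
have [C C0 CV] : exists2 C : set E, nbhs fx C &
    closure C `<=` (fun y => V (y - fx))^°.
  apply: uniform_regular; exact: nbhs_interior.
pose D : set X := K `&` (Ck_fun f : X -> E) @^-1` closure C.
have cD : compact D.
  apply: compact_closedI => //; apply: preimage_closed.
    by move=> y _; exact: Ck_continuous.
  exact: closed_closure.
have fD : (Ck_fun f : X -> E) @` D `<=` (fun y => V (y - fx))^°.
  by move=> _ [y [_ Cy] <-]; exact: CV.
have := Ff _ _ cD (open_interior _) fD => FD.
exists ((Ck_fun f : X -> E) @^-1` C,
  [set g : Ck X E | (Ck_fun g : X -> E) @` D `<=` (fun y => V (y - fx))^°]).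
  by split => //=; exact: (Ck_continuous C0).
move=> [y g] /= [Cy gD] Ky.
have Dy : D y by split => //; exact: subset_closure.
rewrite [_ - _](_ : _ = (Ck_fun g y - fx) - (Ck_fun f y - fx)); last first.
  by rewrite opprB addrA subrK.
apply: VW; apply: (@interior_subset _ (fun y => V (y - fx))).
  by apply: gD; exists y.
by apply: fD; exists y.
Qed.

Lemma Ck_nbhsP f (K : set X) (W : set E) : compact K -> nbhs 0 W ->
  nbhs f [set g : Ck X E | forall x, K x -> W ((Ck_fun g x : E) - Ck_fun f x)].
Proof.
by move=> cK W0; move: K W cK W0; apply/(Ck_cvg0P f (nbhs_filter f)).
Qed.

Lemma Ck_add_continuous : continuous (fun z : Ck X E * Ck X E => z.1 + z.2).
Proof.
move=> [f g]; apply/Ck_cvg0P => K W cK W0.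
have /(_ W) := @add_continuous E (0, 0); rewrite /= addr0 => /(_ W0).
case=> -[A B] /= [A0 B0] AB.
exists ([set h : Ck X E | forall x, K x -> A ((Ck_fun h x : E) - Ck_fun f x)],
  [set h : Ck X E | forall x, K x -> B ((Ck_fun h x : E) - Ck_fun g x)]).
  by split; exact: Ck_nbhsP.
move=> [f' g'] /= [Af Bg] x Kx.
have -> : (Ck_fun (f' + g') x : E) - Ck_fun (f + g) x =
    ((Ck_fun f' x : E) - Ck_fun f x) + ((Ck_fun g' x : E) - Ck_fun g x).
  by rewrite !Ck_addE opprD addrACA.
exact: (AB (_, _) (conj (Af _ Kx) (Bg _ Kx))).
Qed.

Lemma Ck_scale_continuous : continuous (fun z : R^o * Ck X E => z.1 *: z.2).
Proof.
move=> [r f]; apply/Ck_cvg0P => K W cK W0.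
have : \forall z \near (r : R^o, 0 : E), forall x, K x ->
    W (z.1 *: z.2 + (z.1 - r) *: (Ck_fun f x : E)).
  move/compact_near_coveringP : cK => /(_ (R^o * E)%type (nbhs (r : R^o, 0 : E))
    (fun z x => W (z.1 *: z.2 + (z.1 - r) *: (Ck_fun f x : E)))
    (nbhs_filter _)); apply => x Kx.
  have /(_ W) : {for (x, (r : R^o, 0 : E)), continuous (fun z : X * (R^o * E) =>
      z.2.1 *: z.2.2 + (z.2.1 - r) *: (Ck_fun f z.1 : E))}.
    apply: (@continuous_comp _ (E * E)%type E
      (fun z : X * (R^o * E) =>
        (z.2.1 *: z.2.2, (z.2.1 - r) *: (Ck_fun f z.1 : E)))
      (fun z => z.1 + z.2)); last exact: add_continuous.
    apply: cvg_pair.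
      apply: (@continuous_comp _ (R^o * E)%type E snd (fun z => z.1 *: z.2)).
        exact: cvg_snd.
      exact: scale_continuous.
    apply: (@continuous_comp _ (R^o * E)%type E
      (fun z : X * (R^o * E) => (z.2.1 - r : R^o, Ck_fun f z.1 : E))
      (fun z => z.1 *: z.2)); last exact: scale_continuous.
    apply: (@cvg_pair _ _ _ _ (nbhs (r - r : R^o))); last first.
      apply: (@continuous_comp _ X E fst (Ck_fun f)); first exact: cvg_fst.
      exact: Ck_continuous.
    apply: (@cvgB R R^o); last exact: cvg_cst.
    by apply: (@cvg_comp _ _ _ snd fst); [exact: cvg_snd | exact: cvg_fst].
  by rewrite /= scaler0 subrr scale0r addr0; apply.
case=> -[A B] /= [A0 B0] AB.
exists (A,
  [set h : Ck X E | forall x, K x -> B ((Ck_fun h x : E) - Ck_fun f x)]).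
  by split => //; exact: Ck_nbhsP.
move=> [s h] /= [As Bh] x Kx.
have -> : (Ck_fun (s *: h) x : E) - Ck_fun (r *: f) x =
    s *: ((Ck_fun h x : E) - Ck_fun f x) + (s - r) *: (Ck_fun f x : E).
  by rewrite !Ck_scaleE scalerBr scalerBl addrA subrK.
exact: (AB (s, (Ck_fun h x : E) - Ck_fun f x) (conj As (Bh _ Kx)) _ Kx).
Qed.

Lemma Ck_locally_convex : exists2 B : set_system (Ck X E),
  (forall b, b \in B -> convex_set b) & basis B.
Proof.
have [B cB [oB bB]] := @locally_convex R E.
exists [set U : set (Ck X E) | open U /\ convex_set U].
  by move=> U /[!inE] -[].
split=> [U []//|f].
pose I := [set KU : set X * set E |
  [/\ compact KU.1, open KU.2, convex_set KU.2 & KU.2 0]].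
pose N (KU : set X * set E) :=
  [set g : Ck X E | forall x, KU.1 x -> KU.2 ((Ck_fun g x : E) - Ck_fun f x)].
have IB (W : set E) : nbhs 0 W -> exists2 U : set E,
    [/\ open U, convex_set U & U 0] & U `<=` W.
  move=> /bB[U /= [BU U0] UW]; exists U => //; split => //.
    exact: oB.
  by apply: cB; rewrite inE.
have FF : Filter (filter_from I N).
  apply: filter_from_filter.
    exists (set0, setT); split => /=.
    - exact: compact0.
    - exact: openT.
    - by move=> ? ? ? _ _; rewrite inE.
    - by [].
  move=> [K U] [L V] [/= cK oU cU U0] [/= cL oV cV V0].
  exists (K `|` L, U `&` V); first split => /=.
  - by apply: compactU.
  - exact: openI.
  - move=> a b l; rewrite !in_setI => /andP[aU aV] /andP[bU bV].
    by rewrite cU// cV.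
  - by [].
  move=> g /= gN; split => x Kx.
    by have [] := gN x (or_introl Kx).
  by have [] := gN x (or_intror Kx).
have cvgI : filter_from I N --> f.
  apply/Ck_cvg0P => K W cK /IB[U [oU cU U0] UW].
  by exists (K, U) => // g gN x Kx; apply/UW/gN.
move=> M /cvgI [[K U] [/= cK oU cU U0] NM].
exists (N (K, U)) => //; split; last first.
  by move=> x _ /=; rewrite subrr.
split; last first.
  move=> a b l /[!inE] aN bN x /= Kx; apply/set_mem.
  have aU := mem_set (aN x Kx); have bU := mem_set (bN x Kx).
  have := cU _ _ l aU bU; congr (is_true (_ \in U)).
  rewrite [RHS](_ : _ = (l%:num *: (Ck_fun a x : E) +
      (1 - l%:num) *: (Ck_fun b x : E)) - Ck_fun f x) //.
  rewrite /conv /= !scalerBr addrACA -opprD -scalerDl.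
  by rewrite [l%:num + _]addrC subrK scale1r.
rewrite openE => g gN.
have : {for g, continuous (fun h : Ck X E => h - f)}.
  apply: (@continuous_comp _ (Ck X E * Ck X E)%type (Ck X E)
    (fun h => (h, - f)) (fun z => z.1 + z.2)); last exact: Ck_add_continuous.
  apply: (@cvg_pair _ _ _ _ (nbhs g) (nbhs (- f)) (nbhs_filter g)).
    exact: cvg_id.
  exact: (@cvg_cst _ _ _ _ (nbhs_filter g)).
move=> /(_ [set h : Ck X E | (Ck_fun h : X -> E) @` K `<=` U]) /= H.
have : nbhs g [set h : Ck X E | (Ck_fun (h - f) : X -> E) @` K `<=` U].
  apply: H; apply: open_nbhs_nbhs; split; first exact: Ck_open.
  by move=> _ [x Kx <-]; exact: gN.
by apply: filterS => h hU x Kx; apply: hU; exists x.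
Qed.

(* This factory only contributes the uniformity; the three instances after it
   supply the remaining mixins of [tvsType]. *)
HB.instance Definition _ := PreTopologicalLmod_isTvs.Build R (Ck X E)
  Ck_add_continuous Ck_scale_continuous Ck_locally_convex.
HB.instance Definition _ :=
  PreTopologicalNmodule_isTopologicalNmodule.Build (Ck X E) Ck_add_continuous.
HB.instance Definition _ :=
  TopologicalNmodule_isTopologicalLmodule.Build R (Ck X E) Ck_scale_continuous.
HB.instance Definition _ := Uniform_isTvs.Build R (Ck X E) Ck_locally_convex.

End CkTvs.

Section NullSequences.
Context (R : realType).

Definition null_seq : {pred nat -> R^o} :=
  [pred u : nat -> R^o | `[< u n @[n --> \oo] --> (0 : R^o) >]].

Fact null_seq_submod_closed : submod_closed null_seq.
Proof.
split; first by apply/asboolP; exact: cvg_cst.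
move=> a u v /asboolP u0 /asboolP v0; apply/asboolP.
by have := cvgD (cvgZr (k := a) u0) v0; rewrite scaler0 addr0; apply.
Qed.

HB.instance Definition _ :=
  GRing.isSubmodClosed.Build R (nat -> R^o) null_seq null_seq_submod_closed.

Record c0 := C0 { c0_seq :> nat -> R^o ; c0_null : c0_seq \in null_seq }.

HB.instance Definition _ := [isSub for c0_seq].
HB.instance Definition _ := [Choice of c0 by <:].
HB.instance Definition _ := [SubChoice_isSubLmodule of c0 by <:].

Definition c0_norm (u : c0) : R := sup (range (fun n => `|u n|)).

Lemma c0_has_sup (u : c0) : has_sup (range (fun n => `|u n|)).
Proof.
split; first by exists `|u 0%N|, 0%N.
have /asboolP u0 := c0_null u.
have /cvg_seq_bounded [M [_ HM]] : cvgn (u : nat -> R^o).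
  by apply/cvg_ex; exists 0.
by exists (M + 1) => _ [n _ <-]; apply: HM => //; rewrite ltrDl.
Qed.

Lemma c0_norm_ub (u : c0) n : `|u n| <= c0_norm u.
Proof. by apply: ub_le_sup; [case: (c0_has_sup u) | exists n]. Qed.

Lemma c0_norm_le (u : c0) M : (forall n, `|u n| <= M) -> c0_norm u <= M.
Proof.
by move=> uM; apply: ge_sup; [case: (c0_has_sup u) | move=> _ [n _ <-]].
Qed.

Fact c0_normD (u v : c0) : c0_norm (u + v) <= c0_norm u + c0_norm v.
Proof.
apply: c0_norm_le => n; apply: le_trans (ler_normD (u n) (v n)) _.
by apply: lerD; exact: c0_norm_ub.
Qed.

Fact c0_normZ (a : R) (u : c0) : c0_norm (a *: u) = `|a| * c0_norm u.
Proof.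
have le (b : R) (v : c0) : c0_norm (b *: v) <= `|b| * c0_norm v.
  apply: c0_norm_le => n; rewrite [X in X <= _](normrM b (v n)).
  by rewrite ler_wpM2l// c0_norm_ub.
apply/eqP; rewrite eq_le le /=; have [->|a0] := eqVneq a 0.
  by rewrite normr0 mul0r (le_trans _ (c0_norm_ub _ 0%N)).
rewrite -ler_pdivlMl ?normr_gt0// -normfV.
by have := le a^-1 (a *: u); rewrite scalerA mulVf// scale1r.
Qed.

Fact c0_norm0_eq0 (u : c0) : c0_norm u = 0 -> u = 0.
Proof.
move=> u0; apply/val_inj/funext => n; apply/normr0_eq0/le_anti.
by rewrite normr_ge0 -u0 c0_norm_ub.
Qed.

HB.instance Definition _ :=
  Lmodule_isNormed.Build R c0 c0_normD c0_normZ c0_norm0_eq0.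

End NullSequences.

(* Main.v *)
From HB Require Import structures.
From mathcomp Require Import all_boot all_order all_algebra.
From mathcomp Require Import all_classical all_reals all_analysis.
From mathcomp Require Import lra ring.
Require Import Defs.
Set Implicit Arguments.
Unset Strict Implicit.
Unset Printing Implicit Defensive.
Import Order.TTheory GRing.Theory Num.Theory.
Import numFieldNormedType.Exports.
Local Open Scope classical_set_scope.
Local Open Scope ring_scope.

(** It is enough to find continuous linear maps [T : c0 -> Ck X E] and
    [P : Ck X E -> c0] with [P \o T = id]: the range of [T] and the kernel of
    [P] are then complementary ([complemented_copy_of_retraction]).

    The ingredient coming from [E] is a sequence of blocks ([null_blocks]): for
    each [k] there are functionals [y k j] and vectors [g k j], [j < n k], with
    the [y k j] dominated by one continuous seminorm, the [g k j] bounded,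
    [y k j (g k j) = 1], and [(n k)^-1 * \sum_j `|y k j v|] tending to [0] with
    [k] for every [v].  The ingredient coming from [X] is a sequence of points
    [x i] of an infinite compact set [K] and of bumps [f i], equal to [1] at
    [x i], no two of which are nonzero at the same point ([disjoint_bumps]).
    Give each pair [(k, j)] its own bump and let

      [T u = \sum_(k, j) u k * f (k, j) *: g k j],
      [P h = (fun k => (n k)^-1 * \sum_j y k j (h (x (k, j))))].

    Then [P (T u) = u].  The function [T u] is continuous because the bumps are
    disjoint and the vectors [u k *: g k j] tend to [0] uniformly in [j]; and
    [P h] tends to [0] because [h @` K] is precompact, the [y k j] are
    equicontinuous, and the mean of [`|y k j|] over [j] tends to [0] on a finite
    net.

    Null blocks exist in every Frechet space that is not Montel
    ([not_montel_null_blocks]).  With blocks of size one this is the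
    Josefson-Nissenzweig theorem of Bonet, Lindstrom and Valdivia; allowing an
    average over a block is enough for the argument above and makes a short
    proof possible.  Since Frechet spaces are barrelled, some bounded set of [E]
    is not precompact.  By Hahn-Banach there are then a continuous seminorm [p]
    and functionals [y m], dominated by [p], any two of which differ by at least
    [1/2] somewhere on a fixed bounded set ([separated_forms]).

    If some subsequence of [y] converges pointwise, its consecutive differences
    form blocks of size one ([blocks_of_convergent]).

    Otherwise every subsequence oscillates at some point of [E].  A diagonal
    argument fixes the two thresholds [c < d] of the oscillation, and also
    bounds on all the seminorms of a defining sequence, in such a way that for
    each [m] there is a subsequence of [y] all of whose subsequences oscillate
    at points obeying the first [m] bounds ([hsplits_bounded]).
    Rosenthal's argument ([hsplits_independent]) then provides [2 ^ K]
    functionals and [K] points such that every pattern of sides, above [d] or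
    below [c], is realized by one of the functionals at the [K] points
    ([threshold_signs]).  Averaging these functionals against the Rademacher
    functions yields [K] functionals, the [j]-th of which is at least [d - c] at
    the [j]-th point, while orthogonality bounds the mean of their absolute
    values at any vector [v] by [2 * p v / Num.sqrt K].  These are the blocks
    ([blocks_of_oscillating]).  For the block number [k] only the first [k]
    bounds are needed: a seminorm is then controlled on all but finitely many
    blocks, and these are finite sets. *)

(** * Linear forms, seminorms and the Hahn-Banach theorem *)

Section HahnBanach.
Context {R : realType} (E : lmodType R).

Definition linear_form (f : E -> R) : Prop :=
  forall a x y, f (a *: x + y) = a * f x + f y.

Section linear_form.
Variable f : E -> R.
Hypothesis lf : linear_form f.

Lemma linear_form0 : f 0 = 0.
Proof.
have := lf 1 0 0; rewrite scaler0 addr0 mul1r => /eqP.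
by rewrite -subr_eq0 opprD addrA subrr sub0r oppr_eq0 => /eqP.
Qed.

Lemma linear_formD x y : f (x + y) = f x + f y.
Proof. by rewrite -[x in LHS]scale1r lf mul1r. Qed.

Lemma linear_formZ a x : f (a *: x) = a * f x.
Proof. by rewrite -[_ *: _]addr0 lf linear_form0 addr0. Qed.

Lemma linear_formB x y : f (x - y) = f x - f y.
Proof. by rewrite linear_formD -scaleN1r linear_formZ mulN1r. Qed.
End linear_form.

Definition seminorm (p : E -> R) : Prop :=
  (forall x y, p (x + y) <= p x + p y) /\ (forall a x, p (a *: x) = `|a| * p x).

Lemma seminorm0 p : seminorm p -> p 0 = 0.
Proof. by case=> _ hp; rewrite -(scale0r (0 : E)) hp normr0 mul0r. Qed.

Lemma seminormN p x : seminorm p -> p (- x) = p x.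
Proof. by case=> _ hp; rewrite -scaleN1r hp normrN1 mul1r. Qed.

Lemma seminorm_ge0 p x : seminorm p -> 0 <= p x.
Proof.
move=> sp; have := sp.1 x (- x).
by rewrite subrr (seminorm0 sp) (seminormN _ sp) -mulr2n pmulrn_lge0.
Qed.

Lemma seminormB p x y : seminorm p -> p (x - y) <= p x + p y.
Proof. by move=> sp; rewrite -(seminormN y sp); exact: sp.1. Qed.

Section graph.
Variable p : E -> R.
Hypothesis sp : seminorm p.
(** Partial linear forms below [p] are given by their graphs: extension is then
    inclusion, as Zorn's lemma wants it.  That a graph is single-valued follows
    from domination by a seminorm. *)
Definition dominated_graph (G : set (E * R)) : Prop :=
  [/\ G (0, 0),
      forall a u v, G u -> G v -> G (a *: u.1 + v.1, a * u.2 + v.2) &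
      forall u, G u -> u.2 <= p u.1].

Lemma dominated_graph_eq0 G r : dominated_graph G -> G (0, r) -> r = 0.
Proof.
case=> G0 GD Gp Gr; apply/eqP; rewrite eq_le.
have := Gp _ Gr; rewrite /= (seminorm0 sp) => -> /=.
have := Gp _ (GD (-1) _ _ Gr G0); rewrite /= scaler0 !addr0 (seminorm0 sp).
by rewrite mulN1r oppr_le0.
Qed.

Lemma dominated_graph_uniq G x r s : dominated_graph G ->
  G (x, r) -> G (x, s) -> r = s.
Proof.
move=> dG; have [G0 GD _] := dG => Gr Gs; apply/eqP; rewrite -subr_eq0.
apply/eqP/(dominated_graph_eq0 dG).
have := GD (-1) _ _ Gs Gr; rewrite /= scaleN1r mulN1r addNr.
by rewrite [- s + r]addrC.
Qed.

(** The value [c] at [v] has to lie above every [u.2 - p (u.1 - v)] and below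
    every [p (w.1 + v) - w.2]; the triangle inequality makes these requirements
    compatible. *)
Lemma dominated_graph_extend G v : dominated_graph G ->
  exists H, [/\ dominated_graph H, G `<=` H & exists c, H (v, c)].
Proof.
case=> G0 GD Gp.
pose L := [set u.2 - p (u.1 - v) | u in G].
have LU u w : G u -> G w -> u.2 - p (u.1 - v) <= p (w.1 + v) - w.2.
  move=> Gu Gw; rewrite lerBlDr addrAC lerBrDr.
  have := Gp _ (GD 1 _ _ Gu Gw); rewrite /= scale1r mul1r => /le_trans; apply.
  have -> : u.1 + w.1 = (w.1 + v) + (u.1 - v).
    by rewrite addrACA subrr addr0 addrC.
  exact: sp.1.
have supL : has_sup L.
  split; first by exists (0 - p (0 - v)), (0, 0).
  by exists (p (0 + v) - 0) => _ [u Gu <-]; exact: (LU _ (0, 0)).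
pose c := sup L.
have cL u : G u -> u.2 - c <= p (u.1 - v).
  move=> Gu; rewrite lerBlDr -lerBlDl; apply: ub_le_sup; first exact: supL.2.
  by exists u.
have cU w : G w -> w.2 + c <= p (w.1 + v).
  move=> Gw; rewrite addrC -lerBrDr; apply: ge_sup; first exact: supL.1.
  by move=> _ [u Gu <-]; exact: LU.
exists [set u | exists w a, G w /\ u = (w.1 + a *: v, w.2 + a * c)].
split.
- split.
  + by exists (0, 0), 0; split => //=; rewrite scale0r mul0r !addr0.
  + move=> a _ _ [w [b [Gw ->]]] [w' [b' [Gw' ->]]] /=.
    exists (a *: w.1 + w'.1, a * w.2 + w'.2), (a * b + b'); split; first exact: GD.
    rewrite /= scalerDr scalerA addrACA scalerDl; congr pair.
    by rewrite mulrDr mulrA addrACA mulrDl.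
  + move=> _ [w [a [Gw ->]]] /=.
    have scl b (_ : b != 0) : b * (b^-1 * w.2 + 0) = w.2.
      by rewrite addr0 mulrA divff// mul1r.
    have scl' b (_ : b != 0) : b *: (b^-1 *: w.1 + 0) = w.1.
      by rewrite addr0 scalerA divff// scale1r.
    have [a0|a0|->] := ltgtP a 0; last by rewrite scale0r mul0r !addr0 Gp.
    * have := cL _ (GD (- a)^-1 _ _ Gw G0); rewrite -(ler_pM2l (_ : 0 < - a)) ?oppr_gt0//.
      rewrite mulrBr scl ?oppr_eq0 ?lt_eqF// -[X in X * p _]gtr0_norm ?oppr_gt0//.
      by rewrite -sp.2 scalerBr scl' ?oppr_eq0 ?lt_eqF// mulNr scaleNr !opprK.
    * have := cU _ (GD a^-1 _ _ Gw G0); rewrite -(ler_pM2l a0).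
      rewrite mulrDr scl ?gt_eqF// -[X in X * p _]gtr0_norm//.
      by rewrite -sp.2 scalerDr scl' ?gt_eqF//.
- by move=> u Gu; exists u, 0; split => //; rewrite scale0r mul0r !addr0; case: u Gu.
- by exists c, (0, 0), 1; split => //=; rewrite scale1r mul1r !add0r.
Qed.
End graph.

(** The functional norming [z] on its line is extended by Zorn's lemma. *)
Lemma hahn_banach p z : seminorm p ->
  exists f, [/\ linear_form f, f z = p z & forall x, `|f x| <= p x].
Proof.
move=> sp.
pose G0 : set (E * R) := [set (a *: z, a * p z) | a in setT].
have dG0 : dominated_graph p G0.
  split; first by exists 0 => //; rewrite scale0r mul0r.
    move=> a _ _ [b _ <-] [c _ <-] /=; exists (a * b + c) => //.
    by rewrite scalerDl scalerA mulrDl mulrA.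
  move=> _ [a _ <-] /=; rewrite sp.2 ler_wpM2r ?seminorm_ge0//.
  exact: ler_norm.
(* the empty graph is there for the empty chain *)
pose P := [set G : set (E * R) | G = set0 \/ (dominated_graph p G /\ G0 `<=` G)].
have [F FP totF|A [PA Amax]] := @Zorn_bigcup _ P.
  have [[G [FG Gn0]]|F0] := pselect (exists G, F G /\ G <> set0); last first.
    left; apply: bigcup0 => G FG; apply: contrapT => Gn0.
    by apply: F0; exists G.
  have FP' H u : F H -> H u -> dominated_graph p H.
    by move=> /FP [->//|[]].
  have [//|[dG G0G]] := FP _ FG.
  right; split; last by move=> u /G0G Gu; exists G.
  split.
  - by exists G => //; case: dG.
  - move=> a u v [H FH Hu] [K FK Kv].
    have [HK|KH] := totF _ _ FH FK.
      exists K => //; have [_ KD _] := FP' _ _ FK Kv; apply: KD => //.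
      exact: HK.
    exists H => //; have [_ HD _] := FP' _ _ FH Hu; apply: HD => //.
    exact: KH.
  - by move=> u [H FH Hu]; have [_ _ Hp] := FP' _ _ FH Hu; exact: Hp.
have {PA} [dA G0A] : dominated_graph p A /\ G0 `<=` A.
  case: PA => // A0; exfalso; apply: (Amax G0); last by right; split.
  rewrite A0; split => //; move=> /(_ (0, 0)); apply.
  by case: dG0.
have Atot x : exists r, A (x, r).
  have [H [dH AH [c Hc]]] := dominated_graph_extend sp x dA.
  exists c; suff : H `<=` A by apply.
  apply: contrapT => HA; apply: (Amax H) => //.
  by right; split => //; exact: subset_trans AH.
have [f fA] := choice Atot.
have [_ AD Ap] := dA.
have lf : linear_form f.
  move=> a x y; apply: (dominated_graph_uniq sp dA (fA _)).
  exact: (AD a (x, f x) (y, f y)).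
exists f; split=> [//||x].
  apply: (dominated_graph_uniq sp dA (fA _)); apply: G0A.
  by exists 1 => //; rewrite scale1r mul1r.
rewrite ler_norml (Ap _ (fA x)) andbT lerNl -mulN1r -(linear_formZ lf) scaleN1r.
by rewrite -(seminormN x sp) (Ap _ (fA _)).
Qed.
End HahnBanach.

(** * Continuous seminorms of a locally convex space *)

Section ContinuousSeminorms.
Context {R : realType}.

Lemma convex_setP (E : lmodType R) (V : set E) (t : R) (x y : E) :
  convex_set V -> 0 <= t <= 1 -> V x -> V y -> V (t *: x + (1 - t) *: y).
Proof.
move=> cV /andP[t0 t1] Vx Vy.
by have := cV x y (Itv01 t0 t1) (mem_set Vx) (mem_set Vy); rewrite inE.
Qed.

Lemma balancedN (E : lmodType R) (A : set E) x : balanced_set A -> A x -> A (- x).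
Proof.
move=> bA Ax; apply: (bA (-1)); first by rewrite normrN1.
by exists x => //; rewrite scaleN1r.
Qed.

Variable E : tvsType R.
Implicit Types (p q : E -> R) (W : set E).

(** By homogeneity, continuity of a seminorm is a property of its unit ball. *)
Definition cont_seminorm p := seminorm p /\ nbhs 0 [set x | p x < 1].

Lemma nbhs0_scale W (r : R) : r != 0 -> nbhs 0 W -> nbhs 0 [set x | W (r *: x)].
Proof.
move=> r0 W0; have ri : r^-1 != 0 by rewrite invr_eq0.
apply: filterS (nbhs0Z ri W0) => _ [w Ww <-] /=.
by rewrite scalerA divff// scale1r.
Qed.

Lemma cont_seminorm_lt p (e : R) : cont_seminorm p -> 0 < e ->
  nbhs 0 [set x | p x < e].
Proof.
move=> [sp p1] e0; have ei : e^-1 != 0 by rewrite invr_eq0 gt_eqF.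
apply: filterS (nbhs0_scale ei p1) => x /=.
by rewrite sp.2 gtr0_norm ?invr_gt0// mulrC ltr_pdivrMr// mul1r.
Qed.

Lemma nbhs_sub W x : nbhs 0 W -> nbhs x [set y | W (y - x)].
Proof.
move=> W0; apply: filterS (nbhsT x W0) => _ [w Ww <-] /=.
by rewrite addrC addKr.
Qed.

Lemma nbhs_add W x : nbhs x W -> nbhs 0 [set v | W (x + v)].
Proof.
move=> Wx; have := nbhsB (- x) Wx; rewrite addNr.
by apply: filterS => _ [w Ww <-] /=; rewrite addNKr.
Qed.

Lemma absorbing_nbhs W x : nbhs 0 W -> exists2 r : R, 0 < r & W (r *: x).
Proof.
move=> W0; have := @scale_continuous R E (0, x) W; rewrite /= scale0r => /(_ W0).
case=> -[A B] /= [A0 Bx] AB; have [e e0 eA] := A0.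
exists (e / 2); first by rewrite divr_gt0.
apply: (AB (e / 2, x)); split => /=; last exact: nbhs_singleton.
apply: eA => /=; rewrite sub0r normrN gtr0_norm ?divr_gt0//.
by rewrite ltr_pdivrMr// ltr_pMr// ltr1n.
Qed.

(** The seminorm is the gauge of a convex symmetric neighbourhood; this is where
    local convexity enters. *)
Lemma seminorm_in_nbhs W : nbhs 0 W ->
  exists2 p, cont_seminorm p & [set x | p x < 1] `<=` W.
Proof.
move=> W0; have [B cB [oB bB]] := @locally_convex R E.
have [V /= [BV V0] VW] := bB _ _ W0.
have cV : convex_set V by apply: cB; rewrite inE.
have nV : nbhs 0 V by apply: open_nbhs_nbhs; split => //; exact: oB.
pose U : set E := V `&` [set x | V (- x)].
have nU : nbhs 0 U.
  apply: filterI => //; apply: filterS (nbhs0N nV) => _ [v Vv <-] /=.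
  by rewrite opprK.
have UN x : U x -> U (- x) by case=> ? ?; split => //=; rewrite opprK.
have U0 : U 0 by exact: nbhs_singleton.
have cU t x y : 0 <= t <= 1 -> U x -> U y -> U (t *: x + (1 - t) *: y).
  move=> t01 [Vx Vx'] [Vy Vy']; split; first exact: convex_setP.
  by rewrite /= opprD -!scalerN; exact: convex_setP.
have sU (r s : R) x : 0 < r -> r <= s -> U (s *: x) -> U (r *: x).
  move=> r0 rs Us; have s0 := lt_le_trans r0 rs.
  have := cU (r / s) (s *: x) 0; rewrite scaler0 addr0 scalerA divfK ?gt_eqF//.
  apply => //; rewrite ler_pdivrMr// mul1r rs andbT.
  by rewrite divr_ge0// ltW.
pose S x := [set r : R | 0 < r /\ U (r^-1 *: x)].
have S0 x : S x !=set0.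
  have [r r0 Ur] := absorbing_nbhs x nU; exists r^-1.
  by split; rewrite ?invr_gt0// invrK.
have lS x : lbound (S x) 0 by move=> r [r0 _]; exact: ltW.
have iS x : has_inf (S x) by split => //; exists 0; exact: lS.
pose p x := inf (S x).
have pS x r : S x r -> p x <= r by move=> Sr; apply: ge_inf => //; exact: (iS x).2.
have p0 x : 0 <= p x by apply: lb_le_inf.
have Sp x r : p x < r -> S x r.
  rewrite -subr_gt0 => /inf_adherent/(_ (iS x))[s [s0 Us]].
  rewrite subrKC => /ltW sr; split; first exact: lt_le_trans sr.
  by apply: sU Us; rewrite ?invr_gt0 ?lef_pV2 ?posrE// (lt_le_trans s0).
have pZ a x : 0 < a -> p (a *: x) <= a * p x.
  move=> a0; apply/ler_addgt0Pr => e e0.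
  have [] := Sp x (p x + e / a); first by rewrite ltrDl divr_gt0.
  set r := p x + _ => r0 Ur; rewrite (_ : _ + e = a * r); last first.
    by rewrite /r mulrDr mulrCA divff ?gt_eqF// mulr1.
  apply: pS; split; first exact: mulr_gt0.
  by rewrite scalerA invfM mulrAC mulVf ?gt_eqF// mul1r.
have pN x : p (- x) = p x.
  rewrite /p; congr inf; apply/seteqP; split=> r [r0 Ur]; split => //.
    by rewrite -[x]opprK scalerN; exact: UN.
  by rewrite scalerN; exact: UN.
have p00 : p 0 = 0.
  apply/eqP; rewrite eq_le p0 andbT; apply/ler_addgt0Pr => e e0; rewrite add0r.
  by apply: pS; split => //; rewrite scaler0.
have pZ' a x : 0 < a -> p (a *: x) = a * p x.
  move=> a0; apply/eqP; rewrite eq_le pZ//=.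
  have := pZ a^-1 (a *: x); rewrite invr_gt0 scalerA mulVf ?gt_eqF// scale1r.
  by move=> /(_ a0); rewrite mulrC ler_pdivlMr// mulrC.
have sp : seminorm p.
  split=> [x y|a x].
    apply/ler_addgt0Pr => e e0; have e2 : 0 < e / 2 by rewrite divr_gt0.
    have [] := Sp x (p x + e / 2); first by rewrite ltrDl.
    have [] := Sp y (p y + e / 2); first by rewrite ltrDl.
    set s := p y + _; set r := p x + _ => s0 Us r0 Ur.
    rewrite (_ : _ + e = r + s); last by rewrite /r /s [e in LHS]splitr addrACA.
    have rs : 0 < r + s by rewrite addr_gt0.
    apply: pS; split => //.
    have := cU (r / (r + s)) _ _ _ Ur Us.
    have -> : 1 - r / (r + s) = s / (r + s).
      by rewrite -[1](divff (lt0r_neq0 rs)) -mulrBl [r + s]addrC addrK.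
    rewrite !scalerA mulrAC divff ?gt_eqF// mul1r.
    rewrite mulrAC divff ?gt_eqF// mul1r -scalerDr; apply.
    by rewrite ler_pdivrMr// mul1r lerDl divr_ge0 ltW.
  have [a0|a0|->] := ltgtP a 0.
  - by rewrite -pN -scaleNr pZ' ?oppr_gt0// ltr0_norm.
  - by rewrite pZ'// gtr0_norm.
  - by rewrite scale0r normr0 mul0r.
exists p.
  split => //; have h : (2 : R) != 0 by rewrite pnatr_eq0.
  apply: filterS (nbhs0_scale h nU) => x Ux /=.
  rewrite (@le_lt_trans _ _ 2^-1)//; last by rewrite invf_lt1// ltr1n.
  by apply: pS; split => //; rewrite invrK.
by move=> x /Sp[_]; rewrite invr1 scale1r => -[/VW].
Qed.

Lemma cont_seminormZ p (r : R) : 0 < r -> cont_seminorm p ->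
  cont_seminorm (fun x => r * p x).
Proof.
move=> r0 cp; have [sp _] := cp; split.
  split=> [x y|a x]; first by rewrite -mulrDr ler_pM2l// sp.1.
  by rewrite sp.2 mulrCA.
have := cont_seminorm_lt cp (_ : 0 < r^-1); rewrite invr_gt0 => /(_ r0).
by apply: filterS => x /=; rewrite -[r^-1]mul1r ltr_pdivlMr// mulrC.
Qed.

Lemma seminorm_le p q : seminorm p -> seminorm q ->
  (forall x, p x < 1 -> q x < 1) -> forall x, q x <= p x.
Proof.
move=> sp sq pq x; apply/ler_addgt0Pr => e e0.
have r0 : 0 < p x + e by rewrite ltr_wpDl// seminorm_ge0.
have := pq ((p x + e)^-1 *: x); rewrite sp.2 sq.2 gtr0_norm ?invr_gt0//.
by rewrite ![_^-1 * _]mulrC !ltr_pdivrMr// !mul1r ltrDl e0 => /(_ isT)/ltW.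
Qed.

(** One seminorm is chosen inside each ball of radius [n.+1%:R^-1].  The
    comparison [q x <= p n x] is free of constants since the unit ball of [q],
    a neighbourhood of [0], contains that of some [p n]. *)
Lemma metrizable_seminorms : metrizable_space R E ->
  exists p : nat -> E -> R, (forall n, cont_seminorm (p n)) /\
    forall q, cont_seminorm q -> exists n, forall x, q x <= p n x.
Proof.
case=> M [f [g [fK gK cf cg]]].
have fn n : nbhs (0 : E) [set x | ball (f 0) n.+1%:R^-1 (f x)].
  by apply: cf; exact: nbhsx_ballx.
have /choice[p pP] : forall n, exists p, cont_seminorm p /\
    [set x | p x < 1] `<=` [set x | ball (f 0) n.+1%:R^-1 (f x)].
  by move=> n; have [p cp pW] := seminorm_in_nbhs (fn n); exists p.
exists p; split=> [n|q cq]; first by have [] := pP n.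
have : nbhs (f 0) (g @^-1` [set x | q x < 1]).
  by apply: cg; rewrite fK; exact: cq.2.
move/nbhs_ballP => [e /= e0 eq].
have [n ne] : exists n, n.+1%:R^-1 < e.
  exists (Num.truncn e^-1); rewrite invf_plt ?posrE//.
  exact: truncnS_gt.
exists n; apply: seminorm_le; [by have [[]] := pP n|exact: cq.1|].
move=> x /(pP n).2 /= /(le_ball (ltW ne)) /eq /=.
by rewrite fK.
Qed.

Lemma metrizable_hausdorff : metrizable_space R E -> hausdorff_space E.
Proof.
case=> M [f [g [fK gK cf cg]]] x y xy; apply: (can_inj fK).
apply: metric_hausdorff => A B /cf Ax /cf By.
by have [z [Az Bz]] := xy _ _ Ax By; exists (f z).
Qed.

End ContinuousSeminorms.

(** * Frechet spaces are barrelled; separated sequences in non-Montel spaces *)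

Section Frechet.
Context {R : realType} (E : tvsType R).

(** A small [v] is the midpoint of [r *: x0 + v] and [v - r *: x0].  Both are in
    [A]: the first, and the opposite of the second, have the form [r *: x] with
    [x] close to [x0]. *)
Lemma barrel_interior (A : set E) (O : set E) (x0 : E) (r : R) :
  barrel A -> 0 < r -> nbhs x0 O -> (forall x, O x -> A (r *: x)) -> nbhs 0 A.
Proof.
move=> [_ cA bA _] r0 Ox0 OA; have r0' := gt_eqF r0.
have ri : r^-1 != 0 by rewrite invr_eq0 r0'.
have N0 := nbhs0_scale ri (nbhs_add Ox0).
apply: filterS (filterI N0 (nbhs0N N0)) => v [/= Ov [w /= Ow wv]].
have Av : A (r *: x0 + v).
  by have := OA _ Ov; rewrite scalerDr scalerA divff ?r0'// scale1r.
have Aw : A (v - r *: x0).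
  rewrite -wv -opprD; apply: balancedN => //.
  by have := OA _ Ow; rewrite scalerDr scalerA divff ?r0'// scale1r addrC.
have := convex_setP cA (_ : 0 <= 2^-1 <= 1) Av Aw.
rewrite invr_ge0 ler0n/= invf_le1// ler1n => /(_ isT).
have -> : 1 - 2^-1 = 2^-1 :> R by lra.
by rewrite -scalerDr [r *: x0 + v]addrC addrACA subrr addr0 -mulr2n -(scaler_nat 2 v) scalerA
  mulVf ?scale1r// pnatr_eq0.
Qed.

(** This is Baire's argument, run inside the space because its metric need be
    neither complete nor translation invariant.  If the barrel [A] has no
    interior, there are nested nonempty open sets, Cauchy for the seminorms,
    whose closures avoid the successive multiples [n.+1%:R *: A]; their common
    point contradicts that [A] is absorbing. *)
Lemma frechet_barrelled : frechet E -> barrelled E.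
Proof.
move=> [mE cE] A bA; have [clA _ _ abA] := bA.
have [p [cp pE]] := metrizable_seminorms mE.
apply: contrapT => nA.
pose good (O : set E) := open O /\ O !=set0.
have /choice[F FP] : forall On : set E * nat, exists O' : set E, good On.1 ->
   [/\ good O', closure O' `<=` On.1,
     (forall x, closure O' x -> ~ A ((On.2.+1%:R : R)^-1 *: x)) &
     (forall x y, O' x -> O' y -> p On.2 (x - y) < 1)].
  case=> O n /=.
  have [[oO [x0 Ox0]]|] := pselect (good O); last by exists set0.
  have r0 : 0 < (n.+1%:R : R)^-1 by rewrite invr_gt0 ltr0Sn.
  have [x [Ox nAx]] : exists x, O x /\ ~ A (n.+1%:R^-1 *: x).
    apply: contrapT => H; apply: nA; apply: (barrel_interior (x0 := x0) bA r0).
      exact: (open_nbhs_nbhs (conj oO Ox0)).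
    by move=> x Ox; apply: contrapT => nAx; apply: H; exists x.
  have nx : nbhs x (O `&` [set y | ~ A (n.+1%:R^-1 *: y)] `&`
      [set y | p n (y - x) < 2^-1]).
    apply: filterI; last first.
      by apply: nbhs_sub (cont_seminorm_lt _ _) => //; rewrite invr_gt0.
    apply: filterI; first exact: (open_nbhs_nbhs (conj oO Ox)).
    have : nbhs (n.+1%:R^-1 *: x) (~` A).
      by apply: open_nbhs_nbhs; split => //; rewrite openC.
    have := @scale_continuous R E (n.+1%:R^-1, x) (~` A) => /[apply].
    case=> -[/= U V] [/= U0 Vx] UV; apply: filterS Vx => y Vy.
    by apply: (UV (_, y)); split => //; exact: nbhs_singleton.
  have [C Cx CN] := uniform_regular nx.
  exists C°; split => //.
  - by split; [exact: open_interior|exists x; exact: Cx].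
  - by move=> y /(closureS (@interior_subset _ C))/CN[[]].
  - by move=> y /(closureS (@interior_subset _ C))/CN[[]].
  - move=> y z /interior_subset/subset_closure/CN[_ /= py].
    move=> /interior_subset/subset_closure/CN[_ /= pz].
    have -> : y - z = (y - x) - (z - x) by rewrite opprB addrA subrK.
    rewrite (le_lt_trans (seminormB _ _ (cp n).1))//.
    by rewrite [ltRHS]splitr mul1r ltrD.
pose O := fix O n := if n is m.+1 then F (O m, m) else [set: E].
have gO n : good (O n).
  elim: n => [|n gn]; first by split; [exact: openT|exists 0].
  by have [] := FP (O n, n) gn.
have OS n : closure (O n.+1) `<=` O n by have [] := FP (O n, n) (gO n).
have Ole m n : (m <= n)%N -> O n `<=` O m.
  move=> /subnK <-; elim: (n - m)%N => [//|k IH].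
  by apply: subset_trans IH => x Ox; apply: OS; exact: subset_closure.
pose F0 := filter_from [set: nat] O.
have FF : ProperFilter F0.
  apply: filter_from_proper; last by move=> n _; have [] := gO n.
  apply: filter_from_filter; first by exists 0%N.
  move=> i j _ _; exists (maxn i j) => // x Ox.
  by split; apply: Ole Ox; rewrite ?leq_maxl ?leq_maxr.
have cF : tvs_cauchy F0.
  move=> W /seminorm_in_nbhs[q cq qW]; have [n qn] := pE _ cq.
  exists (O n.+1, O n.+1) => /=; first by split; exists n.+1.
  move=> [x y] [/= Ox Oy]; apply: qW => /=; apply: le_lt_trans (qn _) _.
  by have [_ _ _] := FP (O n, n) (gO n); apply.
have [x Fx] := cE _ FF cF.
have xO n : closure (O n) x.
  by move=> V /Fx [m _ mV]; have [y Oy] := (gO (maxn m n)).2; exists y; split;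
   [exact: (Ole _ _ (leq_maxr m n))|apply: mV; exact: (Ole _ _ (leq_maxl m n))].
have [M [_ MP]] := abA x.
pose n := Num.truncn (`|M| + 1).
have Mn : M < n.+1%:R.
  by rewrite (le_lt_trans (ler_norm _))// (lt_trans _ (truncnS_gt _))// ltrDl.
have [a Aa ax] := MP _ Mn.
have [_ _ /(_ x (xO n.+1)) /= + _] := FP (O n, n) (gO n); apply.
by rewrite -ax scalerA mulVf ?scale1r// pnatr_eq0.
Qed.

Lemma ultra_setU (T : Type) (F : set_system T) (A B : set T) :
  UltraFilter F -> F (A `|` B) -> F A \/ F B.
Proof.
move=> UF FAB; have [?|FA] := in_ultra_setVsetC A UF; [by left|right].
by apply: filterS (filterI FAB FA) => x [[]].
Qed.

(** An ultrafilter containing [A] contains one of the finitely many balls that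
    cover [A], whatever the seminorm, so it is Cauchy. *)
Lemma totally_bounded_compact (A : set E) : tvs_complete E -> closed A ->
  (forall p, cont_seminorm p ->
    exists s : seq E, forall x, A x -> exists2 a, a \in s & p (x - a) < 1) ->
  compact A.
Proof.
move=> cE clA tbA; rewrite compact_ultra => F UF FA.
have : tvs_cauchy F.
  move=> W /seminorm_in_nbhs[q cq qW].
  have c2 : cont_seminorm (fun x => 2 * q x) by exact: cont_seminormZ.
  have [s sA] := tbA _ c2.
  have [a Fa] : exists a, F [set x | 2 * q (x - a) < 1].
    have : F [set x | exists2 a, a \in s & 2 * q (x - a) < 1] by exact: filterS sA _.
    elim: s {sA} => [|a s IH] Fs.
      have /filter_ex[x [//]] := Fs.
    have [Fa|/IH//] : F [set x | 2 * q (x - a) < 1] \/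
        F [set x | exists2 a, a \in s & 2 * q (x - a) < 1].
      apply: ultra_setU; apply: filterS Fs => x [b]; rewrite inE => /orP[/eqP->|bs] qb.
        by left.
      by right; exists b.
    by exists a.
  exists ([set x | 2 * q (x - a) < 1], [set x | 2 * q (x - a) < 1]) => //.
  move=> [x y] [/= xa ya]; apply: qW => /=.
  have -> : x - y = (x - a) - (y - a) by rewrite opprB addrA subrK.
  rewrite (le_lt_trans (seminormB _ _ cq.1))//.
  by move: xa ya; rewrite ![2 * _]mulrC -!ltr_pdivlMr//; lra.
case/(cE F _) => x Fx; exists x; split => //.
apply: clA => V /Fx FV; have FAV : F (A `&` V) by exact: filterI.
exact: filter_ex FAV.
Qed.

(** Frechet spaces are Hausdorff and barrelled, so the failure of the Montel
    property comes from a closed bounded set that is not compact, hence not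
    totally bounded for some continuous seminorm. *)
Lemma not_montel_separated : frechet E -> ~ montel E ->
  exists p (a : nat -> E), [/\ cont_seminorm p,
    forall q, cont_seminorm q -> exists r : R, forall n, q (a n) <= r &
    forall m n, (m < n)%N -> 1 <= p (a n - a m)].
Proof.
move=> fE nM; have [mE cE] := fE.
have [A [clA bA ncA]] : exists A : set E, [/\ closed A, tvs_bounded A & ~ compact A].
  apply: contrapT => H; apply: nM; split.
  - exact: metrizable_hausdorff.
  - exact: frechet_barrelled.
  - by move=> A clA bA; apply: contrapT => ncA; apply: H; exists A.
have [p [cp pP]] : exists p, cont_seminorm p /\ forall s : seq E, exists x,
    A x /\ forall a, a \in s -> 1 <= p (x - a).
  apply: contrapT => H; apply: ncA; apply: totally_bounded_compact => // p cp.
  apply: contrapT => Hs; apply: H; exists p; split => // s.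
  apply: contrapT => Hx; apply: Hs; exists s => x Ax.
  apply: contrapT => Ha; apply: Hx; exists x; split => // a sa.
  by rewrite leNgt; apply/negP => pxa; apply: Ha; exists a.
have [f fP] := choice pP.
pose s := fix s n := if n is m.+1 then f (s m) :: s m else [::].
have sP m n : (m < n)%N -> f (s m) \in s n.
  elim: n => // n IH; rewrite ltnS leq_eqVlt => /orP[/eqP ->|/IH ms].
    by rewrite inE eqxx.
  by rewrite inE ms orbT.
exists p, (f \o s); split => //=; last by move=> m n mn; apply: (fP _).2; exact: sP.
move=> q cq; have [r [_ rP]] := bA _ cq.2.
exists (`|r| + 1) => n.
have r1 : r < `|r| + 1 by rewrite (le_lt_trans (ler_norm _))// ltrDl.
have [u /= qu <-] := rP _ r1 _ (fP (s n)).1.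
rewrite cq.1.2 ger0_norm; last by rewrite addr_ge0.
by rewrite ler_piMr ?addr_ge0// ltW.
Qed.

End Frechet.

(** * Oscillating sequences of sets and Rosenthal's independence argument *)

Section Splitting.
Implicit Types (M N : set nat).

Lemma infinite_nat_ge M k : infinite_set M -> exists n, M n /\ (k <= n)%N.
Proof.
move=> iM; apply: contrapT => H; apply: iM.
apply: (sub_finite_set _ (finite_II k)) => n Mn /=.
by rewrite ltnNge; apply/negP => kn; apply: H; exists n.
Qed.

Lemma infinite_nat_unbounded M :
  (forall k, exists n, M n /\ (k <= n)%N) -> infinite_set M.
Proof.
move=> H /finite_seqP[s sM].
have [n [Mn]] := H (\max_(i <- s) i).+1.
rewrite ltnNge => /negP; apply; apply: (@leq_bigmax_seq _ s xpredT id) => //.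
by move: Mn; rewrite sM.
Qed.

Lemma infinite_almost_sub M N : infinite_set M -> finite_set (M `\` N) ->
  infinite_set (M `&` N).
Proof.
by move=> iM fMN fI; apply: iM; rewrite -(setUIDK M N) finite_setU.
Qed.

Lemma infinite_preimage_fin (I : finType) M (f : nat -> I) :
  infinite_set M -> exists i, infinite_set (M `&` [set n | f n = i]).
Proof.
move=> iM; apply: contrapT => H; apply: iM.
have -> : M = \bigcup_(i in [set: I]) (M `&` [set n | f n = i]).
  by apply/seteqP; split=> [n Mn|n [i _ []//]]; exists (f n).
apply: bigcup_finite => [|i _]; first exact: finite_finset.
by apply: contrapT => Hi; apply: H; exists i.
Qed.

Lemma decreasing_sub (S : nat -> set nat) i j :
  (forall i, S i.+1 `<=` S i) -> (i <= j)%N -> S j `<=` S i.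
Proof.
move=> SS /subnK <-; elim: (j - i)%N => // k IH.
by apply: subset_trans IH; exact: SS.
Qed.

(** The diagonal sequence [n] of a decreasing sequence of infinite sets lies
    eventually in each of them, along any infinite set of indices. *)
Lemma diagonal_image (S : nat -> set nat) (n : nat -> nat) (J : set nat) :
  (forall i, S i.+1 `<=` S i) -> (forall i, S i (n i) /\ (i <= n i)%N) ->
  infinite_set J ->
  [/\ infinite_set (n @` J), n @` J `<=` S 0%N &
      forall i, finite_set ((n @` J) `\` S i)].
Proof.
move=> SS nP iJ.
split.
- apply: infinite_nat_unbounded => k.
  have [j [Jj kj]] := infinite_nat_ge k iJ.
  exists (n j); split; first by exists j.
  exact: leq_trans (nP j).2.
- by move=> _ [j _ <-]; exact: (decreasing_sub SS (leq0n j) (nP j).1).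
- move=> i; apply: (sub_finite_set _ (finite_image n (finite_II i))).
  move=> _ [[j Jj <-] nSj]; exists j => //=; rewrite ltnNge; apply/negP => ij.
  by apply: nSj; exact: (decreasing_sub SS ij (nP j).1).
Qed.

Variables (T : Type) (X : bool -> nat -> set T).
Implicit Types (D : set T) (x : T).

(** For the intended sets, [X true m] collects the points where the [m]-th
    function is above an upper threshold and [X false m] those where it is below
    a lower one: the functions with index in [M] oscillate at [x]. *)
Definition splits M x := forall c, infinite_set (M `&` [set n | X c n x]).

(** No subsequence of [M] can be made to converge on [D] with respect to the two
    thresholds.  This hereditary form passes to subsequences and, by
    [hsplits_bigcup] and [hsplits_step], to well-chosen parts of [D]. *)
Definition hsplits D M := forall M', M' `<=` M -> infinite_set M' ->
  exists2 x, D x & splits M' x.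

Lemma splits_almost_sub M N x : finite_set (M `\` N) -> splits M x -> splits N x.
Proof.
move=> fMN sM c; apply: (sub_infinite_set _
  (infinite_almost_sub (N := N) (sM c) _)); first by move=> n [[Mn Xn] Nn].
by apply: sub_finite_set fMN => n [[Mn Xn] Nn].
Qed.

Lemma not_hsplits D M : ~ hsplits D M -> exists M',
  [/\ M' `<=` M, infinite_set M' & forall x, D x -> ~ splits M' x].
Proof.
move=> H; apply: contrapT => H'; apply: H => M' MM' iM'.
apply: contrapT => Hx; apply: H'; exists M'; split => // x Dx sx.
by apply: Hx; exists x.
Qed.

(** Otherwise successive subsequences would stop splitting the points of [D 0],
    [D 1] and so on, and a diagonal subsequence would split no point of the
    union. *)
Lemma hsplits_bigcup (D : nat -> set T) M : infinite_set M ->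
  hsplits (\bigcup_j D j) M ->
  exists j M', [/\ M' `<=` M, infinite_set M' & hsplits (D j) M'].
Proof.
move=> iM hM; apply: contrapT => H.
have /choice[F FP] : forall jN : nat * set nat, exists N', jN.2 `<=` M ->
    infinite_set jN.2 -> [/\ N' `<=` jN.2, infinite_set N' &
    forall x, D jN.1 x -> ~ splits N' x].
  move=> [j N] /=; have [[NM iN]|nN] := pselect (N `<=` M /\ infinite_set N).
    have [|N' N'P] := @not_hsplits (D j) N; last by exists N'.
    by move=> hN; apply: H; exists j, N.
  by exists N => NM iN; exfalso; exact: nN.
pose S := fix S i := if i is j.+1 then F (j, S j) else M.
have SP i : S i `<=` M /\ infinite_set (S i).
  elim: i => [|i [SM iS]]; first by split.
  have [FS iF _] := FP (i, S i) SM iS.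
  by split => //; apply: subset_trans SM.
have SF i := FP (i, S i) (SP i).1 (SP i).2.
have SS i : S i.+1 `<=` S i by have [] := SF i.
have [n nP] := choice (fun i => infinite_nat_ge i (SP i).2).
have [iI IM fI] := diagonal_image SS nP infinite_nat.
have [x [j _ Djx] sx] := hM _ IM iI.
have [_ _ /(_ x Djx)] := SF j; apply.
exact: splits_almost_sub (fI j.+1) sx.
Qed.

(** If every [n] and every subsequence had a further subsequence not splitting
    the points of some [D i `&` X c n], then infinitely many steps of a diagonal
    construction would use the same [i] and [c].  A point of [D i] split by
    these [n] would belong to one of the sets [X c n], hence to a part
    [D i `&` X c n] whose points are not split from that step on. *)
Lemma hsplits_step (I : finType) (D : I -> set T) M : infinite_set M ->
  (forall i, hsplits (D i) M) ->
  exists n M', [/\ M' `<=` M, infinite_set M' &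
    forall i c, hsplits (D i `&` X c n) M'].
Proof.
move=> iM hM; apply: contrapT => H.
have [i0 _] : exists i : I, true.
  apply: contrapT => nI; apply: H; exists 0%N, M; split => // i.
  by exfalso; apply: nI; exists i.
have /choice[F FP] : forall nN : nat * set nat, exists icN : (I * bool) * set nat,
    nN.2 `<=` M -> infinite_set nN.2 -> [/\ icN.2 `<=` nN.2, infinite_set icN.2 &
    forall x, D icN.1.1 x -> X icN.1.2 nN.1 x -> ~ splits icN.2 x].
  move=> [n N] /=; have [[NM iN]|nN] := pselect (N `<=` M /\ infinite_set N).
    have [i [c nh]] : exists i c, ~ hsplits (D i `&` X c n) N.
      apply: contrapT => H'; apply: H; exists n, N; split => // i c.
      by apply: contrapT => nh; apply: H'; exists i, c.
    have [N' [N'N iN' N'P]] := not_hsplits nh.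
    by exists ((i, c), N') => _ _; split => // x Dx Xx; exact: N'P.
  by exists ((i0, true), N) => NM iN; exfalso; exact: nN.
have /choice[el elP] : forall iN : nat * set nat, exists n,
    infinite_set iN.2 -> iN.2 n /\ (iN.1 <= n)%N.
  move=> [i N] /=; have [iN|nN] := pselect (infinite_set N).
    by have [n nP] := infinite_nat_ge i iN; exists n.
  by exists 0%N => iN; exfalso; exact: nN.
pose S := fix S i := if i is j.+1 then (F (el (j, S j), S j)).2 else M.
pose n i := el (i, S i).
have SP i : S i `<=` M /\ infinite_set (S i).
  elim: i => [|i [SM iS]]; first by split.
  have [FS iF _] := FP (n i, S i) SM iS.
  by split => //; apply: subset_trans SM.
have SF i := FP (n i, S i) (SP i).1 (SP i).2.
have SS i : S i.+1 `<=` S i by have [] := SF i.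
have nP i : S i (n i) /\ (i <= n i)%N := elP (i, S i) (SP i).2.
have [[i c] iJ] := infinite_preimage_fin (fun k => (F (n k, S k)).1) infinite_nat.
rewrite setTI in iJ.
have [iI IM fI] := diagonal_image SS nP iJ.
have [x Dx sx] := hM i _ IM iI.
have [_ [[k /= Fk <-] Xx]] := infinite_setN0 (sx c).
have [_ _ /(_ x)] := SF k; rewrite Fk /= => /(_ Dx Xx); apply.
exact: splits_almost_sub (fI k.+1) sx.
Qed.

(** Rosenthal's argument: each step doubles the number of parts, so that after
    [N] steps every sign pattern of length [N] is realized inside every [D i]. *)
Lemma hsplits_independent (I : finType) (D : I -> set T) M (N : nat) :
  infinite_set M -> (forall i, hsplits (D i) M) ->
  exists n : nat -> nat, forall i (s : nat -> bool), exists2 x, D i x &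
    forall k, (k < N)%N -> X (s k) (n k) x.
Proof.
elim: N I D M => [|N IH] I D M iM hM.
  by exists id => i s; have [x Dx _] := hM i M (@subset_refl _ M) iM; exists x.
have [n0 [M' [_ iM' hM']]] := hsplits_step iM hM.
have [n nP] := IH _ (fun ic : I * bool => D ic.1 `&` X ic.2 n0) M' iM'
  (fun ic => hM' ic.1 ic.2).
exists (fun k => if k is j.+1 then n j else n0) => i s.
have [x [Dx Xx] xP] := nP (i, s 0%N) (s \o succn).
by exists x => // -[|k]//= /xP.
Qed.

End Splitting.

(** * Separated functionals and Rademacher averages *)

Section Forms.
Context {R : realType} (E : lmodType R).

Lemma infinite_close (f : nat -> R) (M : set nat) (r : R) :
  infinite_set M -> (forall n, `|f n| <= r) ->
  exists M', [/\ M' `<=` M, infinite_set M' &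
    forall i j, M' i -> M' j -> `|f i - f j| <= 2^-1].
Proof.
move=> iM fr; pose K := Num.truncn (4 * r).
pose h n := Num.truncn (2 * (f n + r)).
have h0 n : 0 <= 2 * (f n + r).
  by have := fr n; rewrite ler_norml => /andP[]; lra.
have hK n : (h n < K.+1)%N.
  rewrite ltnS; apply: le_truncn; have := fr n.
  by rewrite ler_norml => /andP[]; lra.
have [i iMi] := infinite_preimage_fin (fun n => Ordinal (hK n)) iM.
exists (M `&` [set n | Ordinal (hK n) = i]); split => [n []//|//|m n].
move=> [_ /= mi] [_ /= ni]; have hmn : h m = h n.
  by move: mi; rewrite -ni => -[].
have := truncn_itv (h0 m); have := truncn_itv (h0 n); rewrite -/(h m) hmn /h.
rewrite -[(Num.truncn _).+1%:R]natr1; move: (Num.truncn _)%:R => t /andP[n1 n2] /andP[m1 m2].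
by rewrite ler_norml; apply/andP; split; lra.
Qed.

(** Given finitely many functionals, the pigeonhole principle yields two points
    [a i] and [a j] that none of them distinguishes by more than [1/2], while
    some functional dominated by [p] has a value at least [1] at [a i - a j].
    It can be added to the list. *)
Lemma separated_forms (p : E -> R) (a : nat -> E) (r : R) : seminorm p ->
  (forall n, p (a n) <= r) -> (forall m n, (m < n)%N -> 1 <= p (a n - a m)) ->
  exists y : nat -> E -> R, [/\ forall n, linear_form (y n),
    forall n x, `|y n x| <= p x &
    forall m n, (m < n)%N -> exists i j,
      2^-1 <= `|y n (a i - a j) - y m (a i - a j)| ].
Proof.
move=> sp ar sa.
pose ok f := linear_form f /\ forall x, `|f x| <= p x.
have /choice[F FP] : forall s : seq (E -> R), exists f, ok f /\
    ((forall h, List.In h s -> ok h) -> forall h, List.In h s ->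
     exists i j, 2^-1 <= `|f (a i - a j) - h (a i - a j)|).
  move=> s.
  have [os|nos] := pselect (forall h, List.In h s -> ok h); last first.
    by have [f [lf _ fp]] := hahn_banach 0 sp; exists f; split.
  have [M iM MP] : exists2 M, infinite_set M & forall h, List.In h s ->
      forall i j, M i -> M j -> `|h (a i) - h (a j)| <= 2^-1.
    elim: s os => [_|h s IH os]; first by exists setT => //; exact: infinite_nat.
    have [k ks|M iM MP] := IH; first by apply: os; right.
    have [lh hp] := os h (or_introl erefl).
    have [|M' [M'M iM' M'P]] := @infinite_close (h \o a) M r iM.
      by move=> n; exact: le_trans (hp _) (ar n).
    exists M' => // k [<-|ks] i j Mi Mj; first exact: M'P.
    by apply: MP => //; exact: M'M.
  have [j [Mj _]] := infinite_nat_ge 0 iM.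
  have [i [Mi ji]] := infinite_nat_ge j.+1 iM.
  have [f [lf fa fp]] := hahn_banach (a i - a j) sp.
  exists f; split=> // _ h hs; exists i, j.
  have [lh _] := os h hs.
  rewrite fa [h _]linear_formB//; have := MP h hs i j Mi Mj.
  have := sa j i ji; rewrite ler_norml => pa /andP[_ h2].
  by rewrite (le_trans _ (ler_norm _))//; lra.
pose s := fix s n := if n is m.+1 then F (s m) :: s m else [::].
have sok n h : List.In h (s n) -> ok h.
  by elim: n => [//|n IH] [<-|/IH//]; exact: (FP _).1.
have sP m n : (m < n)%N -> List.In (F (s m)) (s n).
  elim: n => // n IH; rewrite ltnS leq_eqVlt => /orP[/eqP ->|/IH ms].
    by left.
  by right.
exists (F \o s); split => [n|n x|m n mn]; [exact: (FP _).1.1|exact: (FP _).1.2|].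
by apply: (FP _).2 => [h|]; [exact: sok|exact: sP].
Qed.

End Forms.

Section Rademacher.
Context {R : realType}.

Definition rademacher (b : bool) : R := (-1) ^+ (~~ b).

Lemma rademacher_orth K (i j : 'I_K) : i != j ->
  \sum_(t : {ffun 'I_K -> bool}) rademacher (t i) * rademacher (t j) = 0.
Proof.
move=> ij; set S := \sum_t _.
pose flip (t : {ffun 'I_K -> bool}) :=
  [ffun l => if l == i then ~~ t l else t l] : {ffun 'I_K -> bool}.
have flipK : involutive flip.
  by move=> t; apply/ffunP => l; rewrite !ffunE; case: eqP; rewrite ?negbK.
suff : S = - S by lra.
rewrite {1}/S (reindex_inj (inv_inj flipK)) -sumrN; apply: eq_bigr => t _.
rewrite !ffunE eqxx (eq_sym j) (negbTE ij) /rademacher -mulNr.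
by case: (t i); rewrite /= ?expr0 ?expr1 ?opprK.
Qed.

Lemma rademacher_sqr_sum K (e : 'I_K -> R) : (forall j, e j ^+ 2 <= 1) ->
  \sum_(t : {ffun 'I_K -> bool}) (\sum_j e j * rademacher (t j)) ^+ 2 <=
  2 ^+ K * K%:R.
Proof.
move=> e1.
under eq_bigr do rewrite expr2 big_distrl/=.
rewrite exchange_big/=.
have -> : 2 ^+ K * K%:R = \sum_(j < K) (2 ^+ K : R).
  by rewrite sumr_const card_ord mulr_natr.
apply: ler_sum => j _.
under eq_bigr do rewrite big_distrr/=.
rewrite exchange_big/= (bigD1 j)//= [X in _ + X]big1 ?addr0 => [|i ij]; last first.
  have := rademacher_orth (_ : j != i); rewrite eq_sym => /(_ ij) oij.
  transitivity (e j * e i * \sum_(t : {ffun 'I_K -> bool})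
      rademacher (t j) * rademacher (t i)); last by rewrite oij mulr0.
  by rewrite big_distrr/=; apply: eq_bigr => t _; rewrite mulrACA.
rewrite (eq_bigr (fun=> e j ^+ 2)) => [|t _]; last first.
  rewrite /rademacher mulrACA -!expr2; case: (t j);
  by rewrite /= ?expr0 ?expr1 ?sqrrN ?expr1n mulr1.
rewrite sumr_const card_ffun card_bool card_ord -[leLHS]mulr_natl natrX.
by rewrite ler_piMr// exprn_ge0.
Qed.

(** With [e j] the sign of the [j]-th average, the left-hand side is the mean
    over [t] of [u t * \sum_j e j * rademacher (t j)].  The mean square of the
    random sum is at most [m.+1 ^ 2] by orthogonality. *)
Lemma rademacher_average m (u : {ffun 'I_(m.+1 * m.+1) -> bool} -> R) (C : R) :
  (forall t, `|u t| <= C) ->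
  \sum_(j < m.+1 * m.+1) `|(2 ^+ (m.+1 * m.+1))^-1 *
    \sum_(t : {ffun 'I_(m.+1 * m.+1) -> bool}) rademacher (t j) * u t| <= C * m.+1%:R.
Proof.
move=> uC; set K := (m.+1 * m.+1)%N.
pose y (j : 'I_K) := (2 ^+ K)^-1 *
  \sum_(t : {ffun 'I_K -> bool}) rademacher (t j) * u t.
rewrite -[leLHS]/(\sum_(j < K) `|y j|).
have C0 : 0 <= C by exact: le_trans (normr_ge0 _) (uC [ffun=> true]).
pose e j : R := Num.sg (y j).
have e1 j : e j ^+ 2 <= 1.
  by rewrite /e sqr_sg; case: (_ != 0); rewrite ?lexx ?ler01.
have T0 : (0 : R) < 2 ^+ K by rewrite exprn_gt0.
have -> : \sum_j `|y j| = (2 ^+ K)^-1 *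
    \sum_t u t * \sum_j e j * rademacher (t j).
  transitivity (\sum_j e j * y j).
    by apply: eq_bigr => j _; rewrite normrEsg.
  rewrite big_distrr/=; under [RHS]eq_bigr do rewrite !big_distrr/=.
  rewrite exchange_big/=; apply: eq_bigr => j _; rewrite /y mulrA big_distrr/=.
  by apply: eq_bigr => t _; ring.
rewrite ler_pdivrMl//.
(* this replaces the Cauchy-Schwarz inequality *)
have h (x : R) : `|x| <= (x ^+ 2 / m.+1%:R + m.+1%:R) / 2.
  have m0 : (0 : R) < m.+1%:R by rewrite ltr0Sn.
  rewrite -subr_ge0.
  have -> : (x ^+ 2 / m.+1%:R + m.+1%:R) / 2 - `|x| =
     (m.+1%:R - `|x|) ^+ 2 / (2 * m.+1%:R).
    by rewrite -(real_normK (num_real x)); field; rewrite gt_eqF.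
  by rewrite divr_ge0 ?sqr_ge0// mulr_ge0// ltW.
pose s (t : {ffun 'I_K -> bool}) := \sum_j e j * rademacher (t j).
apply: (@le_trans _ _ (\sum_t C * ((s t ^+ 2 / m.+1%:R + m.+1%:R) / 2))).
  apply: ler_sum => t _; rewrite (le_trans (ler_norm _))// normrM.
  by apply: ler_pM => //; exact: h.
rewrite -big_distrr/= mulrCA ler_wpM2l//.
rewrite -big_distrl/= ler_pdivrMr// big_split/= -big_distrl/=.
have := rademacher_sqr_sum e1; rewrite -/s => sK.
rewrite sumr_const card_ffun card_bool card_ord -[X in _ + X]mulr_natl natrX.
rewrite (_ : _ * 2 = 2 ^+ K * m.+1%:R + 2 ^+ K * m.+1%:R); last by ring.
rewrite lerD2r ler_pdivrMr ?ltr0Sn// -mulrA -natrM; exact: sK.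
Qed.

End Rademacher.

(** * Null blocks in Frechet spaces that are not Montel *)

Section Blocks.
Context {R : realType} (E : tvsType R).

(** With [n k = 1] these are an equicontinuous sequence of functionals tending
    to [0] pointwise and a bounded sequence of vectors on which they take the
    value [1].  In general only the means over the blocks tend to [0]. *)
Definition null_blocks (p : E -> R) (n : nat -> nat)
    (y : forall k, 'I_(n k) -> E -> R) (g : forall k, 'I_(n k) -> E) : Prop :=
  [/\ forall k, (0 < n k)%N,
      forall k j, linear_form (y k j) /\ forall x, `|y k j x| <= p x,
      forall k j, y k j (g k j) = 1,
      forall q, cont_seminorm q -> exists r : R, forall k j, q (g k j) <= r &
      forall x (e : R), 0 < e -> exists k0, forall k, (k0 <= k)%N ->
        \sum_j `|y k j x| <= e * (n k)%:R].

Lemma null_blocks_normalize p n (y : forall k, 'I_(n k) -> E -> R)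
    (g : forall k, 'I_(n k) -> E) (b : R) :
  0 < b -> (forall k, (0 < n k)%N) ->
  (forall k j, linear_form (y k j) /\ forall x, `|y k j x| <= p x) ->
  (forall k j, b <= `|y k j (g k j)|) ->
  (forall q, cont_seminorm q -> exists r : R, forall k j, q (g k j) <= r) ->
  (forall x (e : R), 0 < e -> exists k0, forall k, (k0 <= k)%N ->
        \sum_j `|y k j x| <= e * (n k)%:R) ->
  null_blocks p y (fun k j => (y k j (g k j))^-1 *: g k j).
Proof.
move=> b0 n0 yp yg gb ylim.
have y0 k j : y k j (g k j) != 0 by rewrite -normr_gt0 (lt_le_trans b0).
split => // [k j|q cq].
  by rewrite (linear_formZ (yp k j).1) mulVf.
have [r rP] := gb q cq; exists (b^-1 * r) => k j.
rewrite cq.1.2 normfV ler_pM ?invr_ge0// ?seminorm_ge0//; first exact: cq.1.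
by rewrite lef_pV2 ?posrE// normr_gt0.
Qed.

(** The thresholds are part of the point, so that choosing them is a case of
    [hsplits_bigcup]. *)
Definition threshold (y : nat -> E -> R) (c : bool) (n : nat) :
    set (E * (rat * rat)) :=
  [set z | if c then ratr z.2.2 < y n z.1 else y n z.1 < ratr z.2.1].

Lemma finite_nat_eventually (P : set nat) :
  finite_set P -> exists k, forall n, (k <= n)%N -> ~ P n.
Proof.
move=> fP; apply: contrapT => H; apply: (infinite_nat_unbounded _ fP) => k.
apply: contrapT => H'; apply: H; exists k => n kn Pn; apply: H'.
by exists n.
Qed.

(** The limit is the upper limit [L] of [y n x] along [M]: the values exceed
    [L - e / 2] infinitely often, so they cannot also be infinitely often below
    [L - e] when no pair of rational thresholds is crossed infinitely often. *)
Lemma unsplit_cauchy (y : nat -> E -> R) (M : set nat) x (r : R) :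
  infinite_set M -> (forall n, `|y n x| <= r) ->
  (forall a b : rat, a < b -> ~ splits (threshold y) M (x, (a, b))) ->
  exists L : R, forall e, 0 < e -> exists k, forall n, (k <= n)%N -> M n ->
    `|y n x - L| <= e.
Proof.
move=> iM yr nsp.
pose S := [set a : R | infinite_set (M `&` [set n | a < y n x])].
have Sr a : S a -> a <= r.
  move=> /infinite_setN0[n [_ /= an]].
  by apply/ltW/(lt_le_trans an)/(le_trans (ler_norm _)).
have hS : has_sup S.
  split; last by exists r => a; exact: Sr.
  exists (- r - 1); rewrite /S /= (_ : _ `&` _ = M)//.
  apply/seteqP; split=> [n []//|n Mn]; split => //=.
  by have := yr n; rewrite ler_norml => /andP[]; lra.
exists (sup S) => e e0.
have [k1 k1P] : exists k, forall n, (k <= n)%N -> ~ (M n /\ sup S + e < y n x).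
  apply: finite_nat_eventually; apply: contrapT => /(ub_le_sup hS.2).
  by rewrite gerDl leNgt e0.
have e2 : 0 < e / 2 by rewrite divr_gt0.
have [a Sa La] := sup_adherent e2 hS.
have [qb] := @rat_in_itvoo R (sup S - e) (sup S - e / 2) ltac:(lra).
rewrite in_itv/= => /andP[qb1 qb2].
have [qa] := @rat_in_itvoo R (sup S - e) (ratr qb) qb1.
rewrite in_itv/= => /andP[qa1 qa2].
have [k2 k2P] : exists k, forall n, (k <= n)%N -> ~ (M n /\ y n x < ratr qa).
  apply: finite_nat_eventually; apply: contrapT => iqa.
  apply: (nsp qa qb); first by rewrite -(ltr_rat R).
  case; last exact: iqa.
  apply: sub_infinite_set Sa => n [Mn /= an]; split => //=.
  by apply: lt_trans an; exact: lt_trans La.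
exists (maxn k1 k2) => n; rewrite geq_max => /andP[k1n k2n] Mn.
have /not_andP[//|/negP] := k1P n k1n; rewrite -leNgt => h1.
have /not_andP[//|/negP] := k2P n k2n; rewrite -leNgt => h2.
by rewrite ler_norml; apply/andP; split; lra.
Qed.

Lemma increasing_enum (M : set nat) : infinite_set M ->
  exists n : nat -> nat, forall k, [/\ M (n k), (k <= n k)%N & (n k < n k.+1)%N].
Proof.
move=> iM; have [f fP] := choice (fun k => infinite_nat_ge k iM).
pose n := fix n k := if k is j.+1 then f (n j).+1 else f 0%N.
have nlt k : (n k < n k.+1)%N by have [] := fP (n k).+1.
exists n => k; split; last exact: nlt.
  by case: k => [|k]; exact: (fP _).1.
by elim: k => [//|k IH]; exact: leq_ltn_trans (nlt k).
Qed.

Section from_separated.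
Variables (p : E -> R) (a : nat -> E) (y : nat -> E -> R).
Hypothesis ab : forall q, cont_seminorm q -> exists r : R, forall n, q (a n) <= r.
Hypothesis ly : forall n, linear_form (y n).
Hypothesis yp : forall n x, `|y n x| <= p x.

(** The consecutive differences along [M] tend to [0] at every point, while each
    of them has modulus at least [1/2] at some [a i - a j], and these vectors
    form a bounded set. *)
Lemma blocks_of_convergent (M : set nat) :
  (forall m n, (m < n)%N -> exists i j,
      2^-1 <= `|y n (a i - a j) - y m (a i - a j)|) ->
  infinite_set M ->
  (forall x (c d : rat), c < d -> ~ splits (threshold y) M (x, (c, d))) ->
  exists n y' g, @null_blocks (fun x => 2 * p x) n y' g.
Proof.
move=> sy iM nsp; have [n nP] := increasing_enum iM.
have nlt k : (n k < n k.+1)%N by have [] := nP k.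
have /choice[b bP] : forall k, exists ij : nat * nat,
    2^-1 <= `|y (n k.+1) (a ij.1 - a ij.2) - y (n k) (a ij.1 - a ij.2)|.
  by move=> k; have [i [j ij]] := sy _ _ (nlt k); exists (i, j).
eexists (fun=> 1%N), _, _.
apply: (@null_blocks_normalize _ _ (fun k _ x => y (n k.+1) x - y (n k) x)
  (fun k _ => a (b k).1 - a (b k).2) 2^-1) => //.
- move=> k _; split=> [c u v|x]; first by rewrite !ly; ring.
  by rewrite (le_trans (ler_normB _ _))// mulr2n mulrDl mul1r lerD.
- move=> q cq; have [r rP] := ab cq; exists (r + r) => k _.
  by rewrite (le_trans (seminormB _ _ cq.1))// lerD.
- move=> x e e0; have [L LP] := unsplit_cauchy iM (yp^~ x) (nsp x).
  have e2 : 0 < e / 2 by rewrite divr_gt0.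
  have [k kP] := LP _ e2; exists k => l kl; rewrite big_ord1 mulr1.
  have [M1 l1 _] := nP l; have [M2 l2 _] := nP l.+1.
  have := kP _ (leq_trans kl l1) M1.
  have := kP _ (leq_trans (leqW kl) l2) M2.
  rewrite !ler_norml => /andP[h1 h2] /andP[h3 h4].
  by apply/andP; split; lra.
Qed.

(** The sets [[set z | h m z <= l%:R]], [l : nat], cover the whole set, so
    [hsplits_bigcup] can impose the bounds one after the other.  The set [M]
    depends on [m], the bounds do not. *)
Lemma hsplits_bounded (T : Type) (X : bool -> nat -> set T) (D : set T)
    (h : nat -> T -> R) (M0 : set nat) : infinite_set M0 -> hsplits X D M0 ->
  exists r : nat -> R, forall m, exists2 M, infinite_set M &
    hsplits X (D `&` [set z | forall i, (i < m)%N -> h i z <= r i]) M.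
Proof.
move=> iM0 hD.
have /choice[F FP] : forall mCM : nat * (set T * set nat),
    exists lM : nat * set nat, infinite_set mCM.2.2 ->
    hsplits X mCM.2.1 mCM.2.2 -> infinite_set lM.2 /\
    hsplits X (mCM.2.1 `&` [set z | h mCM.1 z <= lM.1%:R]) lM.2.
  move=> [m [C M]] /=.
  have [[iM hM]|nh] := pselect (infinite_set M /\ hsplits X C M); last first.
    by exists (0%N, M) => iM hM; exfalso; apply: nh.
  have [|l [M' [_ iM' hM']]] :=
      @hsplits_bigcup _ X (fun l => C `&` [set z | h m z <= l%:R]) M iM.
    move=> N NM iN; have [x Cx sx] := hM N NM iN; exists x => //.
    exists (Num.truncn (h m x)).+1 => //; split => //=.
    exact/ltW/truncnS_gt.
  by exists (l, M').
pose S := fix S m := if m is j.+1 then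
  ((S j).1 `&` [set z | h j z <= (F (j, S j)).1%:R], (F (j, S j)).2)
  else (D, M0).
have SP m : infinite_set (S m).2 /\ hsplits X (S m).1 (S m).2.
  elim: m => [//|m [iM hM]].
  exact: (FP (m, S m)).
exists (fun j => (F (j, S j)).1%:R) => m; exists (S m).2; first exact: (SP m).1.
rewrite (_ : _ `&` _ = (S m).1); first exact: (SP m).2.
elim: m => [|m IH]; first by apply/seteqP; split=> [z []//|z Dz]; split.
rewrite /= -IH; apply/seteqP; split=> [z [Dz zP]|z [[Dz zP] zm]].
  by split; [split => // i im; apply: zP; exact: ltnW|exact: zP].
by split => // i; rewrite ltnS leq_eqVlt => /orP[/eqP ->//|/zP].
Qed.

(** Rosenthal's argument is applied to [2 ^ K] indices, labelled by the sign
    vectors [t] of length [K].  The point [z j] is a witness for the pattern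
    whose entry at the index labelled [t] is [t j]; reading the table the other
    way, every sign vector occurs as the list of sides of one functional at the
    [K] points. *)
Lemma threshold_signs (D : set (E * (rat * rat))) (M : set nat) (K : nat) :
  infinite_set M -> hsplits (threshold y) D M ->
  exists (z : 'I_K -> E * (rat * rat)) (n : {ffun 'I_K -> bool} -> nat),
    (forall j, D (z j)) /\
    forall (j : 'I_K) (t : {ffun 'I_K -> bool}), threshold y (t j) (n t) (z j).
Proof.
move=> iM hD; pose s := enum {ffun 'I_K -> bool}.
pose t0 : {ffun 'I_K -> bool} := [ffun=> true].
have [n nP] := hsplits_independent (size s) iM (fun _ : unit => hD).
have /choice[z zP] : forall j : 'I_K, exists x, D x /\
    forall i, (i < size s)%N -> threshold y (nth t0 s i j) (n i) x.
  by move=> j; have [x Dx xP] := nP tt (fun i => nth t0 s i j); exists x.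
exists z, (fun t => n (index t s)); split=> [j|j t]; first exact: (zP j).1.
have ts : t \in s by rewrite mem_enum.
by have := (zP j).2 (index t s); rewrite index_mem nth_index//; exact.
Qed.

(** The block number [k] consists of the Rademacher averages of [2 ^ K k]
    differences of functionals [y m] and of points obeying the first [k] bounds
    of [hsplits_bounded], so that any given seminorm is bounded on all blocks
    but finitely many. *)
Lemma blocks_of_oscillating (q : nat -> E -> R) :
  (forall q', cont_seminorm q' -> exists i, forall x, q' x <= q i x) ->
  (forall M, infinite_set M -> exists x (c d : rat), c < d /\
    splits (threshold y) M (x, (c, d))) ->
  exists n y' g, @null_blocks (fun x => 2 * p x) n y' g.
Proof.
move=> qP osc.
pose D (l : nat) : set (E * (rat * rat)) :=
    [set z : E * (rat * rat) | z.2.1 < z.2.2 /\ pickle z.2 = l].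
have [|l [M0 [_ iM0 hM0]]] := @hsplits_bigcup _ (threshold y) D setT infinite_nat.
  move=> M _ iM; have [x [c [d [cd sx]]]] := osc M iM.
  by exists (x, (c, d)) => //; exists (pickle (c, d)).
have Dl z1 z2 : D l z1 -> D l z2 -> z1.2 = z2.2.
  by move=> [_ z1l] [_ z2l]; apply: (pcan_inj pickleK); rewrite z1l z2l.
have [z0 Dz0 _] := hM0 M0 (@subset_refl _ _) iM0.
case: z0.2 Dz0.1 (fun z Dz => Dl z z0 Dz Dz0) => c d /= cd {}Dl.
pose b : R := ratr d - ratr c.
have b0 : 0 < b by rewrite subr_gt0 ltr_rat.
have [r rP] := hsplits_bounded (fun i z => q i z.1) iM0 hM0.
(* a perfect square, for [rademacher_average] *)
pose K k := (k.+1 * k.+1)%N.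
have H k : exists zn : ('I_(K k) -> E * (rat * rat)) * ({ffun 'I_(K k) -> bool} -> nat),
    (forall j, D l (zn.1 j) /\ forall i, (i < k)%N -> q i (zn.1 j).1 <= r i) /\
    forall (j : 'I_(K k)) (t : {ffun 'I_(K k) -> bool}),
      threshold y (t j) (zn.2 t) (zn.1 j).
  have [M iM hM] := rP k.
  have [z [n [zD zn]]] := threshold_signs (K k) iM hM.
  by exists (z, n).
pose zn k := projT1 (cid (H k)).
have znP k := projT2 (cid (H k)); rewrite -/(zn _) in znP.
pose g k j := ((zn k).1 j).1.
pose neg k (t : {ffun 'I_(K k) -> bool}) := [ffun j => ~~ t j] : {ffun 'I_(K k) -> bool}.
(* opposite sign vectors put the two functionals on opposite sides at every
   point, so [rademacher (t j) * u k t (g k j)] is at least [b] *)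
pose u k t x := y ((zn k).2 t) x - y ((zn k).2 (neg k t)) x.
have up k t x : `|u k t x| <= 2 * p x.
  by rewrite (le_trans (ler_normB _ _))// mulr2n mulrDl mul1r lerD.
have T0 k : (0 : R) < 2 ^+ K k by rewrite exprn_gt0.
have cT k : (\sum_(t : {ffun 'I_(K k) -> bool}) 1 : R) = 2 ^+ K k.
  by rewrite sumr_const card_ffun card_bool card_ord natrX.
pose y' k (j : 'I_(K k)) x := (2 ^+ K k)^-1 *
  \sum_(t : {ffun 'I_(K k) -> bool}) rademacher (t j) * u k t x.
have nr (c' : bool) : `|rademacher c'| = 1 :> R by rewrite normrX normrN1 expr1n.
eexists K, y', _; apply: (@null_blocks_normalize _ _ y' g b b0) => //.
- move=> k j; split=> [e v w|x].
    rewrite /y' mulrCA -mulrDr; congr (_ * _).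
    rewrite big_distrr/= -big_split/=; apply: eq_bigr => t _.
    by rewrite /u !ly; ring.
  rewrite normrM gtr0_norm ?invr_gt0// ler_pdivrMl//.
  rewrite (le_trans (ler_norm_sum _ _ _))// -cT big_distrl/=.
  by apply: ler_sum => t _; rewrite normrM nr !mul1r.
- move=> k j; rewrite (le_trans _ (ler_norm _))// /y' ler_pdivlMl// -cT big_distrl/=.
  apply: ler_sum => t _; rewrite mul1r.
  have [/(_ j)[Dz _] zt] := znP k.
  have := zt j t; have := zt j (neg k t); rewrite /threshold/= (Dl _ Dz)/= ffunE.
  rewrite /u /rademacher -/(g k j); case: (t j) => /= h1 h2.
    by rewrite mul1r; apply/ltW; rewrite ltrB.
  by rewrite expr1 mulN1r opprB; apply/ltW; rewrite ltrB.
- move=> q' cq'; have [i iP] := qP q' cq'.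
  (* the blocks whose points need not obey the bound on [q i] *)
  pose B := \sum_(k < i.+1) \sum_(j < K k) q' (g k j).
  have B0 : 0 <= B by do 2!apply: sumr_ge0 => ? _; exact: seminorm_ge0 cq'.1.
  exists (`|r i| + B) => k j.
  have [ik|ki] := ltnP i k.
    have [/(_ j)[_ /(_ i ik)] gr _] := znP k.
    by rewrite (le_trans (iP _))// (le_trans gr)// (le_trans (ler_norm _))// lerDl.
  rewrite ler_wpDl// /B (bigD1 (Ordinal (ki : k < i.+1)%N))//= (bigD1 j)//= -addrA.
  rewrite lerDl addr_ge0// sumr_ge0// => *; first exact: seminorm_ge0 cq'.1.
  by apply: sumr_ge0 => *; exact: seminorm_ge0 cq'.1.
- move=> x e e0; exists (Num.truncn (2 * p x / e)) => k kx.
  rewrite (le_trans (rademacher_average (u := fun t => u k t x) (C := 2 * p x) _))//.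
  rewrite /K natrM mulrA ler_wpM2r// [e * _]mulrC -ler_pdivrMr//.
  by rewrite (le_trans (ltW (truncnS_gt _)))// ler_nat ltnS.
Qed.

End from_separated.

Lemma not_montel_null_blocks : frechet E -> ~ montel E ->
  exists p n y g, cont_seminorm p /\ @null_blocks p n y g.
Proof.
move=> fE nM; have [p [a [cp ab sa]]] := not_montel_separated fE nM.
have [r ar] := ab p cp.
have [y [ly yp sy]] := separated_forms cp.1 ar sa.
have [q [cq qP]] := metrizable_seminorms fE.1.
suff [n [y' [g b]]] : exists n y' g, @null_blocks (fun x => 2 * p x) n y' g.
  by exists (fun x => 2 * p x), n, y', g; split => //; exact: cont_seminormZ.
have [[M [iM nsp]]|H] := pselect (exists M, infinite_set M /\ forall x (c d : rat),
    c < d -> ~ splits (threshold y) M (x, (c, d))).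
  exact: (blocks_of_convergent ab ly yp sy iM nsp).
apply: (blocks_of_oscillating ly yp qP) => M iM; apply: contrapT => nsp.
apply: H; exists M; split => // x c d cd sx; apply: nsp.
by exists x, c, d.
Qed.

End Blocks.

(** * Disjoint bumps on Tychonoff spaces *)

Section Bumps.
Context {R : realType} (X : topologicalType).

Definition clamp (u : R) : R := Num.max 0 (Num.min 1 u).

Lemma clamp_itv u : 0 <= clamp u <= 1.
Proof. by rewrite /clamp le_max lexx ge_max ler01 ge_min lexx. Qed.

Lemma clamp0 u : u <= 0 -> clamp u = 0.
Proof.
by move=> u0; rewrite /clamp max_l// ge_min u0 orbT.
Qed.

Lemma clamp1 u : 1 <= u -> clamp u = 1.
Proof. by move=> u1; rewrite /clamp min_l// max_r. Qed.

Lemma clamp_affine_continuous (f : X -> R) (a b : R) :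
  continuous f -> continuous (fun x => clamp (a * f x + b)).
Proof.
move=> cf x; apply: (@continuous_max R X (cst 0) (fun x => Num.min 1 (a * f x + b))).
  exact: cst_continuous.
apply: (@continuous_min R X (cst 1) (fun x => a * f x + b)).
  exact: cst_continuous.
by apply: cvgD; [apply: cvgM; [exact: cvg_cst|exact: cf]|exact: cvg_cst].
Qed.

Hypothesis tX : tychonoff_space X.

Lemma tychonoff_separate (x y : X) : x <> y ->
  exists f : X -> R, [/\ continuous f, f x = 0 & f y = 1].
Proof.
move=> xy; have [cX hX] := tX.
have cy : closed [set y].
  by apply: accessible_closed_set1; exact: hausdorff_accessible.
have [f [cf _ fx fy]] := (@uniform_separatorP X R _ _).1 (cX x [set y] cy xy).
by exists f; split => //; [apply: fx; exists x|apply: fy; exists y].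
Qed.

Definition unit_function (f : X -> R) := continuous f /\ forall z, 0 <= f z <= 1.

(** Let [f] separate two points of [S].  One of the two halves [f >= 1/2] and
    [f <= 1/2] contains infinitely many points of [S]; the bump sits at the
    point in the other half and is zero from the level [1/3] (or [2/3]) on,
    beyond which there is room for [h] to rise from [0] to [1]. *)
Lemma split_infinite (S : set X) : infinite_set S ->
  exists x (f h : X -> R), [/\ S x, unit_function f, unit_function h, f x = 1 &
    (forall z, f z * h z = 0) /\ infinite_set (S `&` [set z | h z = 1])].
Proof.
move=> iS.
have [x [y [Sx Sy xy]]] : exists x y, [/\ S x, S y & x <> y].
  have [x Sx] := infinite_setN0 iS.
  have [y [Sy /= xy]] : S `\` [set x] !=set0.
    apply: infinite_setN0 => fS; apply: iS; rewrite -(setUIDK S [set x]).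
    by rewrite finite_setU; split => //; apply: finite_setIr; exact: finite_set1.
  by exists x, y; split => // xy'; apply: xy.
have core (a : X) (f : X -> R) : S a -> continuous f -> f a = 0 ->
    infinite_set (S `&` [set z | 2^-1 <= f z]) ->
    exists x (f h : X -> R), [/\ S x, unit_function f, unit_function h, f x = 1 &
    (forall z, f z * h z = 0) /\ infinite_set (S `&` [set z | h z = 1])].
  move=> Sa cf fa iSf.
  exists a, (fun z => clamp (- 3 * f z + 1)), (fun z => clamp (6 * f z - 2)).
  split => //.
  - by split; [exact: clamp_affine_continuous|move=> z; exact: clamp_itv].
  - by split; [exact: clamp_affine_continuous|move=> z; exact: clamp_itv].
  - by rewrite fa mulr0 add0r clamp1.
  split=> [z|].
    have [fz|fz] := lerP (f z) (3^-1).
      by rewrite (@clamp0 (6 * _ - 2)) ?mulr0//; lra.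
    by rewrite (@clamp0 (- 3 * _ + 1)) ?mul0r//; lra.
  apply: sub_infinite_set iSf => z [Sz /= fz]; split => //=.
  by rewrite clamp1//; lra.
have [f [cf fx fy]] := tychonoff_separate xy.
have [iSf|fSf] := pselect (infinite_set (S `&` [set z | 2^-1 <= f z])).
  exact: (core x f).
apply: (core y (fun z => 1 - f z)) => //.
- by move=> z; apply: cvgB; [exact: cvg_cst|exact: cf].
- by rewrite fy subrr.
- move=> fS; apply: iS; move: fSf => /contrapT fSf.
  apply: (@sub_finite_set _ _ ((S `&` [set z | 2^-1 <= f z]) `|`
      (S `&` [set z | 2^-1 <= 1 - f z]))); last by rewrite finite_setU.
  by move=> z Sz; have [?|?] := lerP (2^-1) (f z); [left|right]; split => //=; lra.
Qed.

(** The product [c n] of the first [n] functions [h] vanishes wherever one of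
    the first [n] functions [f] does not, and is [1] on [S n]; multiplying by it
    makes the bumps disjoint. *)
Lemma disjoint_bumps (K : set X) : infinite_set K ->
  exists (x : nat -> X) (f : nat -> X -> R), [/\ forall n, K (x n),
    forall n, unit_function (f n), forall n, f n (x n) = 1 &
    forall m n z, m <> n -> f m z * f n z = 0].
Proof.
move=> iK.
have /choice[F FP] : forall S : set X, exists xfh : X * ((X -> R) * (X -> R)),
    infinite_set S -> [/\ S xfh.1, unit_function xfh.2.1, unit_function xfh.2.2,
    xfh.2.1 xfh.1 = 1 & (forall z, xfh.2.1 z * xfh.2.2 z = 0) /\
    infinite_set (S `&` [set z | xfh.2.2 z = 1])].
  move=> S; have [/split_infinite[x [f [h H]]]|nS] := pselect (infinite_set S).
    by exists (x, (f, h)).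
  have [x _] := infinite_setN0 iK.
  by exists (x, (cst 0, cst 0)).
pose S := fix S n := if n is m.+1 then S m `&` [set z | (F (S m)).2.2 z = 1] else K.
have iS n : infinite_set (S n) by elim: n => [//|n /FP[_ _ _ _ []]].
pose x n := (F (S n)).1; pose f n := (F (S n)).2.1; pose h n := (F (S n)).2.2.
pose c := fix c n : X -> R := if n is m.+1 then fun z => c m z * h m z else cst 1.
have uM (u v : X -> R) : unit_function u -> unit_function v ->
    unit_function (fun z => u z * v z).
  move=> [cu u01] [cv v01]; split=> z; first by apply: cvgM; [exact: cu|exact: cv].
  have /andP[? ?] := u01 z; have /andP[? ?] := v01 z.
  by rewrite mulr_ge0// mulr_ile1.
have cU n : unit_function (c n).
  elim: n => [|n IH]; last by apply: uM => //; have [] := FP _ (iS n).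
  by split=> z; [exact: cst_continuous|rewrite /= ler01 lexx].
have c1 n z : S n z -> c n z = 1.
  by elim: n => [//|n IH] [/IH cn hz]; rewrite /= cn mul1r; exact: hz.
have SK n : S n `<=` K by elim: n => [//|n IH] z [/IH].
have fc m n z : (m < n)%N -> f m z * c n z = 0.
  elim: n => // n IH; rewrite ltnS leq_eqVlt => /orP[/eqP ->|/IH fc0] /=.
    by rewrite mulrCA; have [_ _ _ _ [-> _]] := FP _ (iS n); rewrite mulr0.
  by rewrite mulrA fc0 mul0r.
exists x, (fun n z => c n z * f n z); split.
- by move=> n; have [/SK] := FP _ (iS n).
- by move=> n; apply: uM => //; have [] := FP _ (iS n).
- by move=> n; have [Sx _ _ fx _] := FP _ (iS n); rewrite c1// mul1r.
- have cf0 m n z : (m < n)%N -> c m z * f m z * (c n z * f n z) = 0.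
    by move=> /fc fc0; rewrite [c m z * _]mulrC mulrACA fc0 mul0r.
  move=> m n z /eqP; rewrite neq_ltn => /orP[/cf0//|/cf0].
  by rewrite mulrC.
Qed.

End Bumps.

(** * Retractions and continuity through seminorms *)

Section Retract.
Context {R : realType} (G F : tvsType R).

(** The summands are [range T], described as the set of fixed points of
    [T \o P] so that it is visibly closed, and the kernel of [P]. *)
Lemma complemented_copy_of_retraction (T : F -> G) (P : G -> F) :
  hausdorff_space G -> linear T -> linear P -> continuous T -> continuous P ->
  cancel T P -> contains_complemented_copy G F.
Proof.
move=> hG lT lP cT cP TK.
have T0 : T 0 = 0 by have := lT (-1) 0 0; rewrite scaler0 addr0 scaleN1r addNr.
have P0 : P 0 = 0 by have := lP (-1) 0 0; rewrite scaler0 addr0 scaleN1r addNr.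
have PD x y : P (x + y) = P x + P y by have := lP 1 x y; rewrite !scale1r.
have PN x : P (- x) = - P x by have := lP (-1) x 0; rewrite !scaleN1r P0 !addr0.
have cTP : continuous (T \o P) by move=> x; apply: continuous_comp; [exact: cP|exact: cT].
pose G1 := [set x | T (P x) = x]; pose G2 := [set x | P x = 0].
have G1T a : G1 (T a) by rewrite /G1/= TK.
pose h a : G1 := SigSub (mem_set (G1T a)).
have ch : continuous h by apply: continuous_comp_initial; exact: cT.
have cv : continuous (set_val : G1 -> G) by exact: initial_continuous.
have G1v (x : G1) : T (P (set_val x)) = set_val x by exact: (set_mem (valP x)).
exists G1, G2; split.
- split; last first.
    split; first by rewrite inE /G1/= P0.
    by move=> a u v; rewrite !inE /G1/= => uG vG; rewrite lP lT uG vG.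
  have -> : G1 = (fun x => T (P x) - x) @^-1` [set 0].
    apply/seteqP; split=> x /=; first by move=> ->; rewrite subrr.
    by move/eqP; rewrite subr_eq0 => /eqP.
  apply: preimage_closed; last first.
    by apply: accessible_closed_set1; exact: hausdorff_accessible.
  move=> x _; apply: (@continuous_comp _ (G * G)%type _ (fun x => (T (P x), x))
    (fun z => z.1 - z.2)); last exact: sub_continuous.
  by apply: cvg_pair; [exact: cTP|exact: cvg_id].
- split; last first.
    split; first by rewrite inE /G2/= P0.
    by move=> a u v; rewrite !inE /G2/= => uG vG; rewrite lP uG vG scaler0 addr0.
  have -> : G2 = (T \o P) @^-1` [set 0].
    apply/seteqP; split=> x /=; first by move=> ->.
    by move=> TP0; have := TK (P x); rewrite /G2/= TP0 P0.
  apply: preimage_closed; last first.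
    by apply: accessible_closed_set1; exact: hausdorff_accessible.
  by move=> x _; exact: cTP.
- move=> x; exists (T (P x), x - T (P x)); split.
    by split; [exact: G1T|rewrite /G2/= PD PN TK subrr|rewrite /= subrKC].
  move=> [y1 y2] [/= y1G y2G ->].
  by rewrite PD y2G addr0 y1G addrAC subrr add0r.
- exists h, (P \o set_val); split => //.
  + by move=> x; apply: val_inj; exact: G1v.
  + by move=> x; apply: continuous_comp; [exact: cv|exact: cP].
- exists (h \o P); split; last by move=> x; apply: continuous_comp; [exact: cP|exact: ch].
  move=> x1 x2; apply: val_inj; rewrite /= PD.
  by rewrite (set_mem (valP x2) : P (set_val x2) = 0) addr0; exact: G1v.
Qed.

End Retract.

Section SeminormContinuity.
Context {R : realType} (E : tvsType R).

Lemma seminorm_cvg (T : Type) (F : set_system T) (f : T -> E) l : Filter F ->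
  (forall q (e : R), cont_seminorm q -> 0 < e -> F [set z | q (f z - l) < e]) ->
  f @ F --> l.
Proof.
move=> FF H W Wl; have [q cq qW] := seminorm_in_nbhs (nbhs_add Wl).
apply: (@filterS _ F _ [set z | q (f z - l) < 1]); last exact: H.
by move=> z /qW /=; rewrite subrKC.
Qed.

Lemma cvg_seminorm (T : Type) (F : set_system T) (f : T -> E) l q (e : R) :
  Filter F -> f @ F --> l -> cont_seminorm q -> 0 < e ->
  F [set z | q (f z - l) < e].
Proof.
by move=> FF fl cq e0; exact: (fl _ (nbhs_sub l (cont_seminorm_lt cq e0))).
Qed.

Lemma continuous_scalel (X : topologicalType) (f : X -> R) (v : E) (z : X) :
  {for z, continuous f} -> {for z, continuous (fun z => f z *: v)}.
Proof.
move=> cf; apply: (@continuous_comp X (R^o * E)%type E (fun z => (f z : R^o, v))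
  (fun z => z.1 *: z.2)); last exact: scale_continuous.
by apply: (@cvg_pair _ _ _ _ (nbhs (f z : R^o))); [exact: cf|exact: cvg_cst].
Qed.

(** Near covering by the filter of the finite lists that contain a given one. *)
Lemma compact_seminorm_net (X : topologicalType) (K : set X) (f : X -> E) p (e : R) :
  compact K -> continuous f -> cont_seminorm p -> 0 < e ->
  exists s : seq E, forall z, K z -> exists2 h, h \in s & p (f z - h) < e.
Proof.
move=> cK cf cp e0.
pose F := filter_from [set: seq E] (fun s => [set t : seq E | {subset s <= t}]).
have FF : ProperFilter F.
  apply: filter_from_proper; last by move=> s _; exists s.
  apply: filter_from_filter; first by exists [::].
  move=> s t _ _; exists (s ++ t) => // u stu.
  by split=> x xs; apply: stu; rewrite mem_cat xs ?orbT.
move/compact_near_coveringP : cK => /(_ _ F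
  (fun s z => exists2 h, h \in s & p (f z - h) < e)) [] => [z Kz|s _ sP].
  exists ([set z' | p (f z' - f z) < e], [set t : seq E | f z \in t]).
    split => /=; first exact: (cvg_seminorm _ (cf z)).
    by exists [:: f z] => // t; apply; rewrite inE.
  by move=> [z' t] [/= pz zt]; exists (f z).
by exists s; exact: (sP s).
Qed.

End SeminormContinuity.

(** * The retraction of Ck X E onto c0 *)

Section Assembly.
Context {R : realType} (X : topologicalType) (E : tvsType R).
Variables (K : set X) (cK : compact K) (x : nat -> X) (f : nat -> X -> R).
Hypotheses (Kx : forall i, K (x i)) (uf : forall i, unit_function (f i))
  (fx : forall i, f i (x i) = 1)
  (ff : forall i j z, i <> j -> f i z * f j z = 0).
Variables (p : E -> R) (n : nat -> nat) (y : forall k, 'I_(n k) -> E -> R)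
  (g : forall k, 'I_(n k) -> E).
Hypotheses (cp : cont_seminorm p) (nb : null_blocks p y g).
Implicit Types (a : nat -> R) (k : nat) (z : X).

(** The index of the bump that is given to [g k j]. *)
Definition code k (j : 'I_(n k)) : nat := pickle (k, val j).

(** The sum of all [(a k * f (code j) z) *: g k j].  At most one term is nonzero
    at a point, so that this term can be picked instead of summing. *)
Definition spread a z : E :=
  if pselect (exists s : {k & 'I_(n k)}, f (code (tagged s)) z != 0) is left e
  then (a (tag (projT1 (cid e))) * f (code (tagged (projT1 (cid e)))) z) *:
       g (tagged (projT1 (cid e)))
  else 0.

Lemma spreadE a z k (j : 'I_(n k)) : f (code j) z != 0 ->
  spread a z = (a k * f (code j) z) *: g j.
Proof.
move=> fz; rewrite /spread; case: pselect => [e|nz]; last first.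
  by exfalso; apply: nz; exists (Tagged (fun k => 'I_(n k)) j).
case: (cid e) => -[k' j'] /= fz'.
have [cc|/eqP cc] := eqVneq (code j') (code j); last first.
  by have /eqP := ff z cc; rewrite mulf_eq0 (negbTE fz) (negbTE fz').
have [kk] : (k', val j') = (k, val j) by exact: (pcan_inj pickleK).
by move: j' cc {fz'}; rewrite kk => j' cc /val_inj ->.
Qed.

Lemma spread0 a z : (forall k (j : 'I_(n k)), f (code j) z = 0) -> spread a z = 0.
Proof.
move=> f0; rewrite /spread; case: pselect => // e; exfalso.
by case: e => -[k j] /=; rewrite f0 eqxx.
Qed.

Lemma spread_cases z : (exists k (j : 'I_(n k)), f (code j) z != 0) \/
  (forall k (j : 'I_(n k)), f (code j) z = 0).
Proof.
have [[k [j fz]]|H] := pselect (exists k (j : 'I_(n k)), f (code j) z != 0).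
  by left; exists k, j.
right => k j; apply: contrapT => /eqP fz; apply: H; by exists k, j.
Qed.

Lemma spread_linear a b (c : R) z :
  spread (fun k => c * a k + b k) z = c *: spread a z + spread b z.
Proof.
have [[k [j fz]]|f0] := spread_cases z.
  by rewrite !(spreadE _ fz) scalerA -scalerDl mulrDl mulrA.
by rewrite !spread0// scaler0 addr0.
Qed.

Lemma spread_le a z q (r C : R) : seminorm q -> 0 <= C -> 0 <= r ->
  (forall k (j : 'I_(n k)), q (g j) <= r) -> (forall k, `|a k| <= C) ->
  q (spread a z) <= C * r.
Proof.
move=> sq C0 r0 gr aC.
have [[k [j fz]]|f0] := spread_cases z; last first.
  by rewrite spread0// seminorm0// mulr_ge0.
rewrite (spreadE _ fz) sq.2 ler_pM//; first exact: seminorm_ge0.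
have /andP[f0 f1] := (uf (code j)).2 z.
by rewrite normrM (ger0_norm f0) (le_trans _ (aC k))// ler_piMr.
Qed.

(** Where a bump is nonzero, only its term matters nearby.  Elsewhere, finitely
    many terms are small by continuity of their bumps, and all the others are
    small everywhere because [a] tends to [0] and the [g k j] are bounded. *)
Lemma spread_continuous a : a k @[k --> \oo] --> (0 : R) -> continuous (spread a).
Proof.
move=> a0 z0; apply: seminorm_cvg => q e cq e0.
have [[k [j fz0]]|f0] := spread_cases z0.
  have : {for z0, continuous (fun z => (a k * f (code j) z) *: g j)}.
    apply: continuous_scalel.
    by apply: cvgM; [exact: cvg_cst|exact: (uf _).1].
  move/cvg_seminorm => /(_ q e cq e0) H.
  have fn : \forall z \near z0, f (code j) z != 0.
    exact: (cvgr_neq0 _ ((uf (code j)).1 z0)).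
  by apply: filterS2 fn H => z fz; rewrite /= (spreadE _ fz) (spreadE _ fz0).
have [_ _ _ gb _] := nb; have [r rP] := gb q cq.
pose s := `|r| + 1; have s0 : 0 < s by rewrite ltr_pwDr.
have gs k (j : 'I_(n k)) : q (g j) <= s.
  by rewrite (le_trans (rP k j))// (le_trans (ler_norm _))// lerDl.
have [k0 _ k0P] : \forall k \near \oo, `|a k| < e / s.
  have /cvgrPdist_lt/(_ (e / s)) := a0; rewrite divr_gt0// => /(_ isT).
  by apply: filterS => k; rewrite sub0r normrN.
have near0 : \forall z \near z0, forall (k : 'I_k0) (j : 'I_(n k)),
    `|a k * f (code j) z| < e / s.
  apply: filter_forall => k; apply: filter_forall => j.
  have : (fun z => a k * f (code j) z) @ z0 --> (0 : R).
    rewrite -(mulr0 (a k)) -(f0 k j).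
    by apply: cvgM; [exact: cvg_cst|exact: (uf _).1].
  move/cvgrPdist_lt => /(_ (e / s)); rewrite divr_gt0// => /(_ isT).
  by apply: filterS => z; rewrite sub0r normrN.
apply: filterS near0 => z zP; rewrite /= (spread0 a f0) subr0.
have [[k [j fz]]|fz] := spread_cases z; last by rewrite spread0// seminorm0//; exact: cq.1.
rewrite (spreadE _ fz) cq.1.2.
have af : `|a k * f (code j) z| < e / s.
  have [kk|kk] := ltnP k k0; first exact: (zP (Ordinal kk)).
  apply: le_lt_trans (k0P k kk); rewrite normrM ler_piMr//.
  by have /andP[f1 f2] := (uf (code j)).2 z; rewrite ger0_norm.
rewrite (@le_lt_trans _ _ (`|a k * f (code j) z| * s))//; last by rewrite -ltr_pdivlMr.
by rewrite ler_wpM2l.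
Qed.

Definition average k (h : X -> E) : R :=
  (n k)%:R^-1 * \sum_(j < n k) y j (h (x (code j))).

Lemma n_gt0 k : (0 : R) < (n k)%:R.
Proof. by rewrite ltr0n; case: nb. Qed.

Lemma average_linear k (c : R) (h1 h2 : X -> E) :
  average k (fun z => c *: h1 z + h2 z) = c * average k h1 + average k h2.
Proof.
have [_ yl _ _ _] := nb.
rewrite /average mulrCA -mulrDr; congr (_ * _); rewrite big_distrr/= -big_split/=.
by apply: eq_bigr => j _; rewrite (yl k j).1.
Qed.

Lemma average_le k (h : X -> E) (e : R) :
  (forall z, K z -> p (h z) <= e) -> `|average k h| <= e.
Proof.
move=> he; have [_ yl _ _ _] := nb; have n0 := n_gt0 k.
rewrite /average normrM gtr0_norm ?invr_gt0// ler_pdivrMl//.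
rewrite (le_trans (ler_norm_sum _ _ _))//.
rewrite (@le_trans _ _ (\sum_(j < n k) e))//; last first.
  by rewrite sumr_const card_ord mulr_natl.
by apply: ler_sum => j _; rewrite (le_trans ((yl k j).2 _))// he.
Qed.

Lemma average_spread k a : average k (spread a) = a k.
Proof.
have [_ yl yg _ _] := nb.
rewrite /average (eq_bigr (fun=> a k)) => [|j _].
  by rewrite sumr_const card_ord -[a k *+ _]mulr_natl mulKf// gt_eqF// n_gt0.
rewrite (@spreadE _ _ _ j) fx ?oner_eq0// mulr1.
by rewrite (linear_formZ (yl k j).1) yg mulr1.
Qed.

(** The [y k j] are equicontinuous, so each value [h (x i)] may be replaced by a
    point of a finite net of [h @` K].  The mean of the absolute values of the
    [y k j] tends to [0] on the net; summing over the net makes the bound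
    independent of which of its points is used for which [j]. *)
Lemma average_null (h : X -> E) : continuous h ->
  average k h @[k --> \oo] --> (0 : R).
Proof.
move=> ch; have [_ yl _ _ ylim] := nb.
apply/cvgrPdist_le => e e0; have e2 : 0 < e / 2 by rewrite divr_gt0.
have [s sP] := compact_seminorm_net cK ch cp e2.
have [k0 k0P] : exists k0, forall k, (k0 <= k)%N ->
    \sum_(v <- s) \sum_(j < n k) `|y j v| <= e / 2 * (n k)%:R.
  have : forall d, 0 < d -> exists k0, forall k, (k0 <= k)%N ->
      \sum_(v <- s) \sum_(j < n k) `|y j v| <= d * (n k)%:R; last exact.
  elim: s {sP} => [|v s IH] d d0.
    by exists 0%N => k _; rewrite big_nil mulr_ge0// ltW.
  have d2 : 0 < d / 2 by rewrite divr_gt0.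
  have [k1 k1P] := IH _ d2; have [k2 k2P] := ylim v _ d2.
  exists (maxn k1 k2) => k; rewrite geq_max => /andP[h1 h2].
  by rewrite big_cons [d]splitr mulrDl lerD ?k1P ?k2P.
exists k0 => // k /= kk; have n0 := n_gt0 k.
rewrite sub0r normrN /average normrM gtr0_norm ?invr_gt0// ler_pdivrMl//.
have -> : (n k)%:R * e = \sum_(j < n k) e / 2 + e / 2 * (n k)%:R.
  by rewrite sumr_const card_ord -[e / 2 *+ _]mulr_natl; field.
rewrite (le_trans (ler_norm_sum _ _ _))//.
rewrite (le_trans _ (lerD (lexx _) (k0P k kk)))// exchange_big/= -big_split/=.
apply: ler_sum => j _; have [v vs pv] := sP _ (Kx (code j)).
have -> : y j (h (x (code j))) = y j (h (x (code j)) - v) + y j v.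
  by rewrite (linear_formB (yl k j).1) subrK.
rewrite (le_trans (ler_normD _ _))// lerD//.
  by rewrite (le_trans ((yl k j).2 _))// ltW.
by rewrite (big_rem v)//= lerDl sumr_ge0.
Qed.

Definition c0_to_Ck (u : c0 R) : Ck X E :=
  mkCk (@spread_continuous (u : nat -> R) (asboolW (c0_null u))).

Fact Ck_to_c0_null (h : Ck X E) :
  (fun k => average k (Ck_fun h) : R^o) \in @null_seq R.
Proof. by apply/asboolP; exact: average_null (@Ck_continuous _ _ h). Qed.

Definition Ck_to_c0 (h : Ck X E) : c0 R := C0 (Ck_to_c0_null h).

Lemma c0_to_Ck_linear : linear c0_to_Ck.
Proof.
move=> c u v; apply: CkP => z; exact: (spread_linear (u : nat -> R) (v : nat -> R) c z).
Qed.

Lemma Ck_to_c0_linear : linear Ck_to_c0.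
Proof.
move=> c h1 h2; apply: val_inj; apply/funext => k.
exact: (average_linear k c (Ck_fun h1) (Ck_fun h2)).
Qed.

Lemma c0_to_CkK : cancel c0_to_Ck Ck_to_c0.
Proof.
by move=> u; apply: val_inj; apply/funext => k; exact: average_spread.
Qed.

Lemma c0_to_Ck_continuous : continuous c0_to_Ck.
Proof.
move=> u; apply/(Ck_cvg0P _ (fmap_filter _ (nbhs_filter u))) => L W cL /seminorm_in_nbhs[q cq qW].
have [_ _ _ gb _] := nb; have [r rP] := gb q cq.
pose s := `|r| + 1; have s0 : 0 < s by rewrite ltr_pwDr.
have gs k (j : 'I_(n k)) : q (g j) <= s.
  by rewrite (le_trans (rP k j))// (le_trans (ler_norm _))// lerDl.
have si : 0 < (2 * s)^-1 by rewrite invr_gt0 mulr_gt0.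
have /cvgrPdist_le/(_ _ si) : v @[v --> u] --> u by exact: cvg_id.
apply: filterS => v uv z _; apply: qW => /=.
have -> : (Ck_fun (c0_to_Ck v) z : E) - Ck_fun (c0_to_Ck u) z =
    spread (fun k => (v - u : c0 R) k) z.
  have := spread_linear (u : nat -> R) (v : nat -> R) (-1) z.
  rewrite scaleN1r addrC => <-; congr (spread _ z); apply/funext => k.
  by rewrite mulN1r addrC.
rewrite (@le_lt_trans _ _ ((2 * s)^-1 * s))//.
  apply: spread_le; [exact: cq.1|exact: ltW|exact: ltW|exact: gs|] => k.
  by rewrite (le_trans (c0_norm_ub _ _))// -[c0_norm _]/(`|v - u|) distrC.
by rewrite invfM mulfVK ?gt_eqF// invf_lt1// ltr1n.
Qed.

Lemma Ck_to_c0_continuous : continuous Ck_to_c0.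
Proof.
move=> h; apply/(@cvgrPdist_le R (c0 R) _ _ (nbhs_filter h)) => e e0.
have := Ck_nbhsP h cK (cont_seminorm_lt cp e0).
apply: filterS => h' hh'; apply: c0_norm_le => k.
have -> : c0_seq (Ck_to_c0 h - Ck_to_c0 h') k = - (average k
    (fun z => (-1) *: (Ck_fun h z : E) + Ck_fun h' z)).
  by rewrite average_linear mulN1r opprD opprK.
rewrite normrN; apply: average_le => z Kz.
by rewrite scaleN1r addrC ltW// hh'.
Qed.

End Assembly.

Theorem corollary6p5 (R : realType) (X : topologicalType) (E : tvsType R)
  (tychonoffX : tychonoff_space X)
  (infinite_compactX : exists K : set X, compact K /\ infinite_set K)
  (frechetE : frechet E)
  (not_montelE : ~ montel E)
  (frechetCk : frechet (Ck X E))
  (infinite_dimCk : ~ finite_dimensional (Ck X E)) :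
  contains_complemented_copy (Ck X E) (c0 R).
Proof.
have [K [cK iK]] := infinite_compactX.
have [x [f [Kx uf fx ff]]] := @disjoint_bumps R X tychonoffX K iK.
have [p [n [y [g [cp nb]]]]] := not_montel_null_blocks frechetE not_montelE.
apply: (@complemented_copy_of_retraction R (Ck X E) (c0 R)
  (c0_to_Ck uf ff nb) (Ck_to_c0 cK Kx cp nb)).
- exact: metrizable_hausdorff frechetCk.1.
- exact: c0_to_Ck_linear.
- exact: Ck_to_c0_linear.
- exact: c0_to_Ck_continuous.
- exact: Ck_to_c0_continuous.
- exact: c0_to_CkK.
Qed.
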